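(* Let $G_1,G_2$ be weighted graphs with edgeweights in $[-1,1]$. (a) Let $F$ be a simple graph. Then $|t(F,G_1)-t(F,G_2)|\le 4|E(F)|\,\delta_\square(G_1,G_2)$. (b) Let $k\ge 1$ be an integer, and assume that $|t(F,G_1)-t(F,G_2)|\le 3^{-k^2}$ for every simple graph $F$ on $k$ nodes. Then $$\delta_\square(G_1,G_2)\le\frac{22}{\sqrt{\log_2 k}}$$ (for $k=1$ the right-hand side is read as $+\infty$).
   Context: A weighted graph $G$ is a finite graph with nonempty node set $V(G)$, a weight $\alpha_i=\alpha_i(G)>0$ for each node $i$, and a real weight $\beta_{ij}=\beta_{ij}(G)=\beta_{ji}(G)$ for each edge $ij$ (loops $i=j$ are allowed); one sets $\beta_{ij}=0$ if $ij$ is not an edge. Put $\alpha_G=\sum_i\alpha_i(G)$. A simple graph is a finite graph without loops or multiple edges. Homomorphism densities: for a simple graph $F$ on $k$ nodes and a weighted graph $G$, $$t(F,G)=\frac{1}{\alpha_G^{k}}\sum_{\phi:V(F)\to V(G)}\ \prod_{i\in V(F)}\alpha_{\phi(i)}(G)\prod_{ij\in E(F)}\beta_{\phi(i)\phi(j)}(G),$$ the sum running over all maps. Cut distance: for $S,T\subseteq V(G)$ let $e_G(S,T)=\sum_{i\in S,\,j\in T}\alpha_i\alpha_j\beta_{ij}$. If $G,G'$ are weighted graphs on the same node set $V$ with the same nodeweights, $d_\square(G,G')=\max_{S,T\subseteq V}\frac{1}{\alpha_G^2}|e_G(S,T)-e_{G'}(S,T)|$. If $G$ and $G'$ have $n$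 and $n'$ nodes and $\alpha_G=\alpha_{G'}=1$, a fractional overlay of $G$ and $G'$ is a nonnegative $n\times n'$ matrix $X$ with $\sum_u X_{iu}=\alpha_i(G)$ for all $i$ and $\sum_i X_{iu}=\alpha_u(G')$ for all $u$; $G[X]$ and $G'[X^\top]$ are the weighted graphs on $[n]\times[n']$ in which node $(i,u)$ has weight $X_{iu}$ and the edge $((i,u),(j,v))$ has weight $\beta_{ij}(G)$ in $G[X]$ and $\beta_{uv}(G')$ in $G'[X^\top]$ (here zero nodeweights are harmless). Then $\delta_\square(G,G')=\min_X d_\square(G[X],G'[X^\top])$ over all fractional overlays $X$. For general total nodeweights, first divide all nodeweights of $G$ by $\alpha_G$ and those of $G'$ by $\alpha_{G'}$. *)

(* Defs.v *)
From HB Require Import structures.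
From mathcomp Require Import all_boot all_order all_algebra.
From mathcomp Require Import all_classical all_reals all_analysis.

Set Implicit Arguments.
Unset Strict Implicit.
Unset Printing Implicit Defensive.

Import Order.TTheory GRing.Theory Num.Theory.
Import numFieldNormedType.Exports.

Local Open Scope ring_scope.

Record sgraph := SGraph {
  vertex : finType;
  adj : rel vertex;
  adj_sym : symmetric adj;
  adj_irr : irreflexive adj }.

(* Each edge [ij] is listed once, as the pair [(i, j)] whose first component
   comes first in the enumeration of [vertex F]. *)
Definition edges (F : sgraph) : {set vertex F * vertex F} :=
  [set e : vertex F * vertex F
    | adj e.1 e.2 && (enum_rank e.1 < enum_rank e.2)%N]%SET.

(* Node and edge weights on the node set [V]; non-edges have edge weight [0].
   The conditions on the weights are kept apart, in [weighted_graph], because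
   the graphs [G[X]] below may have nodes of weight [0]. *)
Record wgraph (R : realType) (V : finType) := WGraph {
  nodew : V -> R;
  edgew : V -> V -> R }.

Definition weighted_graph (R : realType) (V : finType) (G : wgraph R V) : Prop :=
  [/\ (0 < #|V|)%N,
      forall i, 0 < nodew G i
    & forall i j, edgew G i j = edgew G j i].

Definition edgew_unit (R : realType) (V : finType) (G : wgraph R V) : Prop :=
  forall i j, -1 <= edgew G i j <= 1.

Definition total_nodew (R : realType) (V : finType) (G : wgraph R V) : R :=
  \sum_i nodew G i.

Definition hom_density (R : realType) (V : finType) (F : sgraph)
    (G : wgraph R V) : R :=
  (total_nodew G ^+ #|vertex F|)^-1 *
  \sum_(phi : {ffun vertex F -> V})
     (\prod_i nodew G (phi i)) *
     \prod_(e in edges F) edgew G (phi e.1) (phi e.2).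

Definition eweight (R : realType) (V : finType) (G : wgraph R V)
    (S T : {set V}) : R :=
  \sum_(i in S) \sum_(j in T) nodew G i * nodew G j * edgew G i j.

(* Only meant for [G] and [G'] with the same node weights.  The base value [0]
   of the maximum is harmless, as all the terms are nonnegative. *)
Definition cut_dist (R : realType) (V : finType) (G G' : wgraph R V) : R :=
  \big[Num.max/0]_(ST : {set V} * {set V})
    ((total_nodew G ^+ 2)^-1 * `|eweight G ST.1 ST.2 - eweight G' ST.1 ST.2|).

Definition wnormalize (R : realType) (V : finType) (G : wgraph R V)
    : wgraph R V :=
  WGraph (fun i => nodew G i / total_nodew G) (edgew G).

Definition frac_overlay (R : realType) (V V' : finType)
    (G : wgraph R V) (G' : wgraph R V') (X : V -> V' -> R) : Prop :=
  [/\ forall i u, 0 <= X i u,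
      forall i, \sum_u X i u = nodew G i
    & forall u, \sum_i X i u = nodew G' u].

(* [overlay_l G X] is [G[X]] and [overlay_r G' X] is [G'[X^T]], both on the
   node set [V * V']. *)
Definition overlay_l (R : realType) (V V' : finType) (G : wgraph R V)
    (X : V -> V' -> R) : wgraph R (V * V')%type :=
  WGraph (fun p => X p.1 p.2) (fun p q => edgew G p.1 q.1).

Definition overlay_r (R : realType) (V V' : finType) (G' : wgraph R V')
    (X : V -> V' -> R) : wgraph R (V * V')%type :=
  WGraph (fun p => X p.1 p.2) (fun p q => edgew G' p.2 q.2).

Definition overlay_dists (R : realType) (V V' : finType)
    (G : wgraph R V) (G' : wgraph R V') : set R :=
  [set d | exists2 X, frac_overlay G G' X
                    & d = cut_dist (overlay_l G X) (overlay_r G' X)]%classic.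

(* The infimum is attained, see [delta_cut_min]. *)
Definition delta_cut (R : realType) (V V' : finType)
    (G : wgraph R V) (G' : wgraph R V') : R :=
  inf (overlay_dists (wnormalize G) (wnormalize G')).

Definition log2 (R : realType) (x : R) : R := ln x / ln 2.

Lemma total_nodew_gt0 (R : realType) (V : finType) (G : wgraph R V) :
  weighted_graph G -> 0 < total_nodew G.
Proof.
move=> [/card_gt0P[i0 _] w0 _]; rewrite /total_nodew (bigD1 i0)//=.
by rewrite ltr_wpDr// sumr_ge0// => i _; exact: ltW.
Qed.

Lemma total_wnormalize (R : realType) (V : finType) (G : wgraph R V) :
  weighted_graph G -> total_nodew (wnormalize G) = 1.
Proof.
move=> /total_nodew_gt0 t0; rewrite {1}/total_nodew /= -mulr_suml.
by rewrite divff// gt_eqF.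
Qed.

Lemma frac_overlay_prod (R : realType) (V V' : finType)
    (G : wgraph R V) (G' : wgraph R V') :
  weighted_graph G -> weighted_graph G' ->
  frac_overlay (wnormalize G) (wnormalize G')
    (fun i u => nodew (wnormalize G) i * nodew (wnormalize G') u).
Proof.
move=> wG wG'; have t0 := total_nodew_gt0 wG; have t0' := total_nodew_gt0 wG'.
split=> [i u|i|u].
- have [_ w0 _] := wG; have [_ w0' _] := wG'.
  by rewrite mulr_ge0//= divr_ge0// ltW.
- by rewrite -mulr_sumr [X in _ * X](total_wnormalize wG') mulr1.
- by rewrite -mulr_suml [X in X * _](total_wnormalize wG) mul1r.
Qed.

Lemma sum_continuous (R : realType) (T : topologicalType) (I : Type)
    (r : seq I) (P : pred I) (F : I -> T -> R) :
  (forall i, continuous (F i)) ->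
  continuous (fun x => \sum_(i <- r | P i) F i x).
Proof.
by move=> cF; apply: continuous_big => //; exact: (@add_continuous R^o).
Qed.

Lemma dist_continuous (R : realType) (T : topologicalType) (f g : T -> R) :
  continuous f -> continuous g -> continuous (fun x => `|f x - g x|).
Proof.
by move=> cf cg x; apply: cvg_norm; apply: cvgB; [exact: cf|exact: cg].
Qed.

Lemma eweight_continuous (R : realType) (T : topologicalType) (V : finType)
    (Y : T -> wgraph R V) (A B : {set V}) :
  (forall i, continuous (fun x => nodew (Y x) i)) ->
  (forall x y, edgew (Y x) = edgew (Y y)) ->
  continuous (fun x => eweight (Y x) A B).
Proof.
move=> cY eY; apply: sum_continuous => i; apply: sum_continuous => j x.
rewrite (_ : (fun _ => _) = (fun y =>
    nodew (Y y) i * nodew (Y y) j * edgew (Y x) i j)); last first.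
  by apply/funext => y; rewrite (eY y x).
apply: cvgM; last exact: cvg_cst.
by apply: cvgM; exact: cY.
Qed.

Lemma delta_cut_min (R : realType) (V V' : finType)
    (G : wgraph R V) (G' : wgraph R V')
    (wG : weighted_graph G) (wG' : weighted_graph G') :
  overlay_dists (wnormalize G) (wnormalize G') (delta_cut G G') /\
  lbound (overlay_dists (wnormalize G) (wnormalize G')) (delta_cut G G').
Proof.
rewrite /delta_cut; set H := wnormalize G; set H' := wnormalize G'.
pose N := #|{: V * V'}|.
pose X (v : 'rV[R]_N) i u := v ord0 (enum_rank (i, u)).
pose f v := cut_dist (overlay_l H (X v)) (overlay_r H' (X v)).
pose A : set 'rV[R]_N := [set v | frac_overlay H H' (X v)]%classic.
pose row (Y : V -> V' -> R) : 'rV[R]_N :=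
  \row_k Y (enum_val k).1 (enum_val k).2.
have rowK Y : X (row Y) = Y.
  by apply/funext => i; apply/funext => u; rewrite /X mxE enum_rankK.
have cX i u : continuous (fun v => X v i u) by exact: coord_continuous.
have A0 : (A !=set0)%classic.
  by eexists (row _); rewrite /A /= rowK; exact: frac_overlay_prod.
have cA : compact A.
  pose B : set 'rV[R]_N :=
    [set v | forall k, `[0, nodew H (enum_val k).1]%classic (v ord0 k)]%classic.
  apply: (@subclosed_compact _ _ B).
  - have -> : A = ((\bigcap_(p in [set: V * V'])
                     (fun v => X v p.1 p.2) @^-1` [set x | 0 <= x]) `&`
                   (\bigcap_(i in [set: V])
                     (fun v => \sum_u X v i u) @^-1` [set x | x = nodew H i]) `&`
                   (\bigcap_(u in [set: V'])
                     (fun v => \sum_i X v i u) @^-1` [set x | x = nodew H' u]))%classic.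
      apply/seteqP; split=> [v [h1 h2 h3]|v [[h1 h2] h3]].
        by split; [split|] => [p _|i _|u _] /=.
      by split=> [i u|i|u]; [exact: (h1 (i, u) I)|exact: h2|exact: h3].
    apply: closedI; [apply: closedI|]; apply: closed_bigI => p _;
      apply: preimage_closed.
    + by move=> x _; exact: cX.
    + exact: closed_ge.
    + by move=> x _; apply: sum_continuous => u; exact: cX.
    + exact: closed_eq.
    + by move=> x _; apply: sum_continuous => u; exact: cX.
    + exact: closed_eq.
  - apply: (@rV_compact R^o N
      (fun k => `[0, nodew H (enum_val k).1]%classic)) => k.
    exact: segment_compact.
  - move=> v [h1 h2 _] k /=.
    have -> : v ord0 k = X v (enum_val k).1 (enum_val k).2.
      by rewrite /X -surjective_pairing enum_valK.
    rewrite in_itv /= h1 /=; apply: (@le_trans _ _ (nodew H (enum_val k).1)) => //.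
    by rewrite -h2 (bigD1 (enum_val k).2)//= lerDl sumr_ge0.
pose g v : R := \big[Num.max/0]_(ST : {set V * V'} * {set V * V'})
    `|eweight (overlay_l H (X v)) ST.1 ST.2
       - eweight (overlay_r H' (X v)) ST.1 ST.2|.
have fg v : A v -> f v = g v.
  move=> [_ h2 _]; rewrite /f /g /cut_dist.
  suff -> : total_nodew (overlay_l H (X v)) = 1.
    by apply: eq_bigr => ST _; rewrite expr1n invr1 mul1r.
  rewrite -(total_wnormalize wG) /total_nodew.
  by under [RHS]eq_bigr do rewrite -h2; rewrite pair_big.
have cg0 ST : continuous (fun v => `|eweight (overlay_l H (X v)) ST.1 ST.2
                                   - eweight (overlay_r H' (X v)) ST.1 ST.2|).
  have cl : continuous (fun v => eweight (overlay_l H (X v)) ST.1 ST.2).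
    by apply: eweight_continuous => // -[i u]; exact: cX.
  have cr : continuous (fun v => eweight (overlay_r H' (X v)) ST.1 ST.2).
    by apply: eweight_continuous => // -[i u]; exact: cX.
  exact: dist_continuous.
have cg : continuous g.
  apply: continuous_big => [x|ST _]; last exact: cg0.
  by apply: (@continuous_max R (R * R)%type fst snd);
    [exact: cvg_fst|exact: cvg_snd].
have [c /set_mem Ac minc] :=
  compact_EVT_min A0 cA (continuous_subspaceT cg).
suff -> : inf (overlay_dists H H') = g c.
  split.
    by exists (X c); [exact: Ac|rewrite -fg].
  move=> _ [Y oY ->]; rewrite -(rowK Y) -[leRHS]/(f _) fg ?minc ?inE /A/= ?rowK//.
have lbc : lbound (overlay_dists H H') (g c).
  move=> _ [Y oY ->]; rewrite -(rowK Y) -[leRHS]/(f _) fg ?minc ?inE /A/= ?rowK//.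
have gc : overlay_dists H H' (g c) by exists (X c); [exact: Ac|rewrite -fg].
apply/eqP; rewrite eq_le; apply/andP; split.
  by apply: ge_inf => //; exists (g c).
by apply: lb_le_inf => //; exists (g c).
Qed.

(* Main.v *)
Require Import Defs.
From HB Require Import structures.
From mathcomp Require Import all_boot all_order all_algebra.
From mathcomp Require Import all_classical all_reals all_analysis.
From mathcomp Require Import ring lra.

(* Part (a): an optimal overlay puts both graphs on one node set; replacing the
   edge weights of the first by those of the second one edge of F at a time
   changes the density by the value of a bilinear form in the difference at
   [-1,1]-valued functions, which is at most 4 times the cut norm.

   Part (b): sample k nodes x of a graph at random, then independent random
   signs s_ij whose means are the sampled edge weights.  The probability of
   a sign pattern is 2^-N times a signed sum of densities t(F, G) with F on k
   nodes, so the hypothesis makes the two laws of s nearly equal, and some s is a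
   typical outcome for both graphs.  It remains to see that the signed complete
   graph s is on average close to G.  With K a Frieze-Kannan step approximation
   of G, use an overlay of G and [k] that matches the classes of K as well as
   possible; the error then consists of the deviation of the class sizes, of the
   cut norm of the noise s - G[x], bounded through a fourth moment, and of the
   cut norm of (G - K)[x].  For the latter, as in Alon, Fernandez de la Vega,
   Kannan and Karpinski, optimal row and column sets are nearly determined by
   their traces on small random subsamples; given a subsample and a trace the
   sets are fixed, and a second moment bound suffices for the union over the
   traces.  If k >= 2^(10h), then subsamples of size 4h and 4^(4h) classes give
   the error 3 / sqrt h up to exponentially small terms. *)

Set Implicit Arguments.
Unset Strict Implicit.
Unset Printing Implicit Defensive.

Import Order.TTheory GRing.Theory Num.Theory.
Import numFieldNormedType.Exports.

Local Open Scope ring_scope.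

(** * Expectations over product weights *)

Lemma eq_ler (R : numDomainType) (x y : R) : x = y -> x <= y.
Proof. by move=> ->. Qed.

Definition is_dist (R : numDomainType) (T : finType) (p : T -> R) : Prop :=
  (forall t, 0 <= p t) /\ \sum_t p t = 1.

Definition Ex (R : numDomainType) (I T : finType) (p : I -> T -> R)
    (F : {ffun I -> T} -> R) : R :=
  \sum_(x : {ffun I -> T}) (\prod_i p i (x i)) * F x.

Definition mix (I T : finType) (A : {set I}) (x y : {ffun I -> T}) :
  {ffun I -> T} := [ffun i => if i \in A then x i else y i].

Section Expectation.
Variables (R : realFieldType) (I T : finType) (p : I -> T -> R).
Implicit Types (F G : {ffun I -> T} -> R) (A : {set I}).

Lemma eq_Ex F G : F =1 G -> Ex p F = Ex p G.
Proof. by move=> FG; apply: eq_bigr => x _; rewrite FG. Qed.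

Lemma ExD F G : Ex p (fun x => F x + G x) = Ex p F + Ex p G.
Proof. by rewrite /Ex -big_split; apply: eq_bigr => x _; rewrite mulrDr. Qed.

Lemma ExZ c F : Ex p (fun x => c * F x) = c * Ex p F.
Proof. by rewrite /Ex mulr_sumr; apply: eq_bigr => x _; rewrite mulrCA. Qed.

Lemma ExB F G : Ex p (fun x => F x - G x) = Ex p F - Ex p G.
Proof.
under eq_Ex do rewrite -mulN1r.
by rewrite ExD ExZ mulN1r.
Qed.

Lemma Ex_sum (J : Type) (r : seq J) (P : pred J) (F : J -> {ffun I -> T} -> R) :
  Ex p (fun x => \sum_(j <- r | P j) F j x) = \sum_(j <- r | P j) Ex p (F j).
Proof.
by rewrite /Ex exchange_big /=; apply: eq_bigr => x _; rewrite mulr_sumr.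
Qed.

Hypothesis dp : forall i, is_dist (p i).

Lemma Ex_cst c : Ex p (fun=> c) = c.
Proof.
rewrite /Ex -mulr_suml -(bigA_distr_bigA p) big1 ?mul1r // => i _.
by case: (dp i).
Qed.

Lemma le_Ex F G : (forall x, F x <= G x) -> Ex p F <= Ex p G.
Proof.
move=> FG; apply: ler_sum => x _; apply: ler_wpM2l => //.
by apply: prodr_ge0 => i _; case: (dp i).
Qed.

Lemma Ex_le F c : (forall x, F x <= c) -> Ex p F <= c.
Proof. by move=> /le_Ex; rewrite Ex_cst. Qed.

Lemma Ex_ge0 F : (forall x, 0 <= F x) -> 0 <= Ex p F.
Proof. by move=> F0; rewrite -(Ex_cst 0); apply: le_Ex. Qed.

Lemma ler_norm_Ex F : `|Ex p F| <= Ex p (fun x => `|F x|).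
Proof.
rewrite /Ex; apply: (le_trans (ler_norm_sum _ _ _)); apply: ler_sum => x _.
by rewrite normrM ger0_norm // prodr_ge0 // => i _; case: (dp i).
Qed.

(* The coordinates in [A] and those outside [A] are independent: [mix A x y] has
   the same law as [x] because [(x, y) |-> (mix A x y, mix A y x)] is an
   involution that preserves the product weight. *)
Lemma Ex_mix A F : Ex p F = Ex p (fun x => Ex p (fun y => F (mix A x y))).
Proof.
pose w (x : {ffun I -> T}) := \prod_i p i (x i).
pose sw (z : {ffun I -> T} * {ffun I -> T}) := (mix A z.1 z.2, mix A z.2 z.1).
have swK : involutive sw.
  by case=> x y; apply/pair_equal_spec; split; apply/ffunP => i;
    rewrite !ffunE /= ?ffunE; case: ifP => iA; rewrite ?iA.
transitivity (\sum_x \sum_y w x * w y * F x).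
  rewrite /Ex; apply: eq_bigr => x _; rewrite -mulr_suml -mulr_sumr.
  rewrite (_ : \sum_y w y = 1) ?mulr1 // -[RHS](Ex_cst 1).
  by apply: eq_bigr => y _; rewrite mulr1.
rewrite pair_bigA (reindex_inj (inv_inj swK)).
rewrite -(pair_bigA _ (fun x y =>
  w (mix A x y) * w (mix A y x) * F (mix A x y))) /=.
apply: eq_bigr => x _; rewrite mulr_sumr; apply: eq_bigr => y _.
rewrite mulrA; congr (_ * _); rewrite /w -!big_split; apply: eq_bigr => i _ /=.
by rewrite !ffunE; case: ifP => // _; rewrite mulrC.
Qed.

(** After [Ex_mix], [F] depends only on the outer draw and [G] only on the inner one. *)
Lemma Ex_indep A F G :
  (forall x y, F (mix A x y) = F x) -> (forall x y, G (mix A x y) = G y) ->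
  Ex p (fun x => F x * G x) = Ex p F * Ex p G.
Proof.
move=> FA GA; rewrite (Ex_mix A).
under eq_Ex => x do (under eq_Ex do rewrite FA GA; rewrite ExZ mulrC).
by rewrite ExZ mulrC.
Qed.

Lemma Ex_marg1 i (f : T -> R) :
  Ex p (fun x => f (x i)) = \sum_t p i t * f t.
Proof.
pose q j t := if j == i then p i t * f t else p j t.
transitivity (\prod_j \sum_t q j t).
  rewrite bigA_distr_bigA; apply: eq_bigr => x _.
  rewrite (bigD1 i) //= [RHS](bigD1 i) //= /q eqxx mulrAC; congr (_ * _).
  by apply: eq_bigr => j /negbTE ->.
rewrite (bigD1 i) //= /q eqxx [X in _ * X]big1 ?mulr1 // => j /negbTE ->.
by case: (dp j).
Qed.

Lemma Ex_marg2 i j (f : T -> T -> R) : i != j ->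
  Ex p (fun x => f (x i) (x j)) = \sum_t \sum_u p i t * p j u * f t u.
Proof.
move=> ij; rewrite (Ex_mix [set i]).
under eq_Ex => x.
  under eq_Ex do rewrite !ffunE !inE eqxx eq_sym (negbTE ij).
  rewrite (Ex_marg1 j (fun u => f (x i) u)); over.
rewrite /= (Ex_marg1 i (fun t => \sum_u p j u * f t u)).
apply: eq_bigr => t _; rewrite mulr_sumr; apply: eq_bigr => u _.
by rewrite mulrA.
Qed.

End Expectation.

Lemma Ex_exchange (R : realFieldType) (I T I' T' : finType) (p : I -> T -> R)
    (p' : I' -> T' -> R) (F : {ffun I -> T} -> {ffun I' -> T'} -> R) :
  Ex p (fun x => Ex p' (F x)) = Ex p' (fun y => Ex p (F^~ y)).
Proof.
rewrite /Ex; under eq_bigr do rewrite mulr_sumr.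
rewrite exchange_big; apply: eq_bigr => y _; rewrite mulr_sumr.
by apply: eq_bigr => x _; rewrite mulrCA.
Qed.

Lemma amgm_norm (R : realFieldType) (x c : R) : 0 < c ->
  `|x| <= (x ^+ 2 / c + c) / 2.
Proof.
move=> c0; rewrite ler_pdivlMr // -subr_ge0.
have -> : x ^+ 2 / c + c - `|x| * 2 = (`|x| - c) ^+ 2 / c.
  by rewrite -(real_normK (num_real x)); field; rewrite gt_eqF.
by rewrite divr_ge0 ?sqr_ge0 // ltW.
Qed.

(* A square-root-free form of [E |F| <= sqrt (E F^2)]. *)
Lemma Ex_amgm (R : realFieldType) (I T : finType) (p : I -> T -> R)
    (F : {ffun I -> T} -> R) c : (forall i, is_dist (p i)) -> 0 < c ->
  Ex p (fun x => `|F x|) <= (Ex p (fun x => F x ^+ 2) / c + c) / 2.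
Proof.
move=> dp c0; apply: (le_trans (le_Ex dp (fun x => amgm_norm (F x) c0))).
have E x : (F x ^+ 2 / c + c) / 2 = (2 * c)^-1 * F x ^+ 2 + c / 2.
  by field; rewrite gt_eqF.
rewrite (eq_Ex _ E) ExD ExZ Ex_cst //; apply: eq_ler.
by field; rewrite gt_eqF.
Qed.

(** Independent centered summands are orthogonal, so only the diagonal of the expanded square
    survives. *)
Lemma Ex_sum_var (R : realFieldType) (I T : finType) (p : T -> R) (a : T -> R) :
  is_dist p -> \sum_t p t * a t = 0 ->
  Ex (fun _ : I => p) (fun x => (\sum_i a (x i)) ^+ 2)
  = #|I|%:R * \sum_t p t * a t ^+ 2.
Proof.
move=> dp a0; have dp' := fun _ : I => dp.
under eq_Ex => x do rewrite expr2 big_distrlr /=.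
rewrite Ex_sum -sumr_const mulr_suml; apply: eq_bigr => i _.
rewrite mul1r Ex_sum (bigD1 i) //= big1 ?addr0 => [|j ji].
  by rewrite -(Ex_marg1 dp' i); apply: eq_Ex => x; rewrite expr2.
rewrite (@Ex_marg2 _ _ _ _ dp' i j (fun t u => a t * a u)) 1?eq_sym //.
transitivity ((\sum_t p t * a t) * (\sum_t p t * a t)); last by rewrite a0 mul0r.
rewrite big_distrlr /=.
by apply: eq_bigr => t _; apply: eq_bigr => u _; rewrite mulrACA.
Qed.

(** * Cut norms and the counting lemma *)

Definition bform (R : numDomainType) (T : finType) (p : T -> R)
    (U : T -> T -> R) (f g : T -> R) : R :=
  \sum_x \sum_y p x * p y * U x y * (f x * g y).

Definition unit_fun (R : numDomainType) (T : finType) (f : T -> R) : Prop :=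
  forall x, 0 <= f x <= 1.

(** Fractional test functions give the same bound as sets ([cut_le_sets]) and, unlike sets, can be
    averaged over the fibres of a map, as the transport to overlays requires. *)
Definition cut_le (R : numDomainType) (T : finType) (p : T -> R)
    (U : T -> T -> R) (e : R) : Prop :=
  forall f g, unit_fun f -> unit_fun g -> `|bform p U f g| <= e.

Section CutNorm.
Variables (R : realFieldType) (T : finType).
Implicit Types (p f g : T -> R) (U : T -> T -> R).

Lemma unit_fun_mem (P : pred T) : unit_fun (fun x => (P x)%:R : R).
Proof. by move=> x; rewrite ler0n lern1 leq_b1. Qed.

Lemma unit_fun_extreme (a f : T -> R) : unit_fun f ->
  \sum_x a x * f x <= \sum_(x in [set x | 0 < a x]) a x.
Proof.
move=> f01; rewrite [leRHS]big_mkcond; apply: ler_sum => x _; rewrite inE.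
have /andP[f0 f1] := f01 x.
by case: ltP => a0; nra.
Qed.

Lemma bform_mem p U (S S' : {set T}) :
  bform p U (fun x => (x \in S)%:R) (fun x => (x \in S')%:R)
  = \sum_(x in S) \sum_(y in S') p x * p y * U x y.
Proof.
rewrite [RHS]big_mkcond; apply: eq_bigr => x _; case: ifP => _; last first.
  by rewrite big1 // => y _; rewrite mul0r mulr0.
rewrite [RHS]big_mkcond; apply: eq_bigr => y _; rewrite mul1r.
by case: ifP => _; rewrite ?mulr1 ?mulr0.
Qed.

Lemma bformN p U f g : bform p (fun x y => - U x y) f g = - bform p U f g.
Proof.
rewrite /bform -sumrN; apply: eq_bigr => x _; rewrite -sumrN.
by apply: eq_bigr => y _; rewrite mulrN mulNr.
Qed.

Lemma bformD p U U' f g :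
  bform p (fun x y => U x y + U' x y) f g = bform p U f g + bform p U' f g.
Proof.
rewrite /bform -big_split; apply: eq_bigr => x _; rewrite -big_split.
by apply: eq_bigr => y _; rewrite mulrDr mulrDl.
Qed.

(** The form is linear in each argument: for fixed [g] the best [f] is the indicator of the positive
    coefficients, and then likewise for [g]. *)
Lemma bform_extreme p U f g : unit_fun f -> unit_fun g ->
  exists S S' : {set T},
    bform p U f g <= \sum_(x in S) \sum_(y in S') p x * p y * U x y.
Proof.
move=> f01 g01.
pose a x := \sum_y p x * p y * U x y * g y; pose S := [set x | 0 < a x].
pose b y := \sum_(x in S) p x * p y * U x y; pose S' := [set y | 0 < b y].
exists S, S'; apply: (@le_trans _ _ (\sum_x a x * f x)).
  apply: eq_ler; apply: eq_bigr => x _; rewrite mulr_suml.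
  by apply: eq_bigr => y _; rewrite [f x * _]mulrC mulrA.
apply: (le_trans (unit_fun_extreme a f01)).
rewrite -/S exchange_big /= [leLHS](_ : _ = \sum_y b y * g y).
  by rewrite [leRHS]exchange_big; exact: (unit_fun_extreme b).
by apply: eq_bigr => y _; rewrite mulr_suml.
Qed.

Lemma cut_le_sets p U e :
  (forall S S' : {set T},
     `|\sum_(x in S) \sum_(y in S') p x * p y * U x y| <= e) -> cut_le p U e.
Proof.
move=> Ue f g f01 g01; rewrite ler_norml; apply/andP; split.
  rewrite lerNl -bformN.
  have [S [S' /le_trans]] := bform_extreme p (fun x y => - U x y) f01 g01; apply.
  apply: le_trans (Ue S S'); rewrite -normrN; apply: le_trans (ler_norm _).
  apply: eq_ler; rewrite -sumrN; apply: eq_bigr => x _; rewrite -sumrN.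
  by apply: eq_bigr => y _; rewrite mulrN.
have [S [S' /le_trans]] := bform_extreme p U f01 g01; apply.
exact: le_trans (ler_norm _) (Ue S S').
Qed.

Lemma eq_bform p U U' f f' g g' : (forall x y, U x y = U' x y) -> f =1 f' ->
  g =1 g' -> bform p U f g = bform p U' f' g'.
Proof.
move=> UU ff gg; apply: eq_bigr => x _; apply: eq_bigr => y _.
by rewrite UU ff gg.
Qed.

Lemma bformBl p U f f' g :
  bform p U (fun x => f x - f' x) g = bform p U f g - bform p U f' g.
Proof.
rewrite /bform -sumrB; apply: eq_bigr => x _; rewrite -sumrB.
by apply: eq_bigr => y _; rewrite mulrBl mulrBr.
Qed.

Lemma bformBr p U f g g' :
  bform p U f (fun x => g x - g' x) = bform p U f g - bform p U f g'.
Proof.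
rewrite /bform -sumrB; apply: eq_bigr => x _; rewrite -sumrB.
by apply: eq_bigr => y _; rewrite !mulrBr.
Qed.

Lemma cut_le_bound p U M : is_dist p -> (forall x y, `|U x y| <= M) ->
  cut_le p U M.
Proof.
move=> [p0 p1] UM f g f01 g01.
have -> : M = \sum_x \sum_y p x * p y * M.
  under eq_bigr do rewrite -mulr_suml -mulr_sumr p1 mulr1.
  by rewrite -mulr_suml p1 mul1r.
apply: (le_trans (ler_norm_sum _ _ _)); apply: ler_sum => x _.
apply: (le_trans (ler_norm_sum _ _ _)); apply: ler_sum => y _.
have /andP[f0 f1] := f01 x; have /andP[g0 g1] := g01 y.
rewrite -mulrA normrM ger0_norm ?mulr_ge0 // ler_wpM2l ?mulr_ge0 //.
rewrite normrM [X in _ * X]ger0_norm ?mulr_ge0 // -[leRHS]mulr1.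
by apply: ler_pM; rewrite ?mulr_ge0 ?mulr_ile1.
Qed.

(* A [-1,1]-valued function is the difference of two [0,1]-valued ones. *)
Lemma cut_le_signed p U e f g : cut_le p U e ->
  (forall x, `|f x| <= 1) -> (forall x, `|g x| <= 1) ->
  `|bform p U f g| <= 4 * e.
Proof.
move=> Ue f1 g1.
pose pos h (x : T) : R := Num.max (h x) 0; pose neg h (x : T) : R := Num.max (- h x) 0.
have posu h : (forall x, `|h x| <= 1) -> unit_fun (pos h).
  move=> h1 x; have := h1 x; rewrite ler_norml /pos => /andP[??].
  by case: (leP (h x) 0) => ?; apply/andP; split; lra.
have negu h : (forall x, `|h x| <= 1) -> unit_fun (neg h).
  move=> h1 x; have := h1 x; rewrite ler_norml /neg => /andP[??].
  by case: (leP (- h x) 0) => ?; apply/andP; split; lra.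
have dec h x : h x = pos h x - neg h x.
  by rewrite /pos /neg; case: (leP (h x) 0) => ?; case: (leP (- h x) 0) => ?; lra.
rewrite (eq_bform p (fun _ _ => erefl) (dec f) (dec g)) bformBl !bformBr.
have := Ue _ _ (posu _ f1) (posu _ g1); have := Ue _ _ (posu _ f1) (negu _ g1).
have := Ue _ _ (negu _ f1) (posu _ g1); have := Ue _ _ (negu _ f1) (negu _ g1).
rewrite !ler_norml => /andP[??] /andP[??] /andP[??] /andP[??].
by apply/andP; split; lra.
Qed.

End CutNorm.

Section Counting.
Variables (R : realFieldType) (I T : finType) (p : T -> R).
Hypothesis dp : is_dist p.

(* Conditionally on all the coordinates but [i] and [j], the two other factors
   are functions of [phi i] and of [phi j] alone. *)
Lemma counting_edge (U : T -> T -> R) e (i j : I) (A B : {ffun I -> T} -> R) :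
  cut_le p U e -> i != j ->
  (forall phi, `|A phi| <= 1) -> (forall phi, `|B phi| <= 1) ->
  (forall phi psi : {ffun I -> T}, (forall l, l != j -> phi l = psi l) -> A phi = A psi) ->
  (forall phi psi : {ffun I -> T}, (forall l, l != i -> phi l = psi l) -> B phi = B psi) ->
  `|Ex (fun=> p) (fun phi => U (phi i) (phi j) * (A phi * B phi))| <= 4 * e.
Proof.
move=> Ue ij A1 B1 Aj Bi; have dp' := fun _ : I => dp.
rewrite (Ex_mix dp' (~: [set i; j])).
apply: (le_trans (ler_norm_Ex dp' _)); apply: Ex_le => // phi.
pose upd l t : {ffun I -> T} := [ffun l' => if l' == l then t else phi l'].
pose f t := A (upd i t); pose g t := B (upd j t).
have -> : Ex (fun=> p) (fun psi => U (mix (~: [set i; j]) phi psi i)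
      (mix (~: [set i; j]) phi psi j) *
      (A (mix (~: [set i; j]) phi psi) * B (mix (~: [set i; j]) phi psi))) =
    bform p U f g.
  have mI psi l : mix (~: [set i; j]) phi psi l =
      if (l == i) || (l == j) then psi l else phi l.
    by rewrite ffunE !inE; case: (_ || _).
  rewrite /bform.
  under [RHS]eq_bigr do under eq_bigr do rewrite -mulrA.
  rewrite -(Ex_marg2 dp' (fun t u => U t u * (f t * g u)) ij).
  apply: eq_Ex => psi; rewrite !mI !eqxx orbT /=; congr (_ * (_ * _)).
    apply: Aj => l lj; rewrite mI ffunE (negbTE lj) orbF.
    by case: eqP => // ->.
  apply: Bi => l li; rewrite mI ffunE (negbTE li).
  by rewrite /=; case: eqP => // ->.
by apply: cut_le_signed => // x; [apply: A1|apply: B1].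
Qed.

Lemma norm_prod_le1 (J : Type) (r : seq J) (P : pred J) (F : J -> R) :
  (forall j, P j -> `|F j| <= 1) -> `|\prod_(j <- r | P j) F j| <= 1.
Proof.
move=> F1; rewrite normr_prod; apply: (@le_trans _ _ (\prod_(j <- r | P j) 1)).
  by apply: ler_prod => j Pj; rewrite normr_ge0 F1.
by rewrite big1_eq.
Qed.

(** Telescoping over the edges: [s] lists those that already carry [W1], and each exchange is an
    instance of [counting_edge]. *)
Lemma counting (E : {set I * I}) (W1 W2 : T -> T -> R) e :
  (forall d, d \in E -> d.1 != d.2) ->
  (forall d, d \in E -> (d.2, d.1) \notin E) ->
  (forall t u, `|W1 t u| <= 1) -> (forall t u, `|W2 t u| <= 1) ->
  cut_le p (fun t u => W1 t u - W2 t u) e ->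
  `|Ex (fun=> p) (fun phi : {ffun I -> T} => \prod_(d in E) W1 (phi d.1) (phi d.2))
    - Ex (fun=> p) (fun phi => \prod_(d in E) W2 (phi d.1) (phi d.2))|
  <= 4 * #|E|%:R * e.
Proof.
move=> Eirr Easym W11 W21 We.
pose K (s : seq (I * I)) d := if d \in s then W1 else W2.
have K1 s d t u : `|K s d t u| <= 1 by rewrite /K; case: ifP.
pose H s (phi : {ffun I -> T}) := \prod_(d in E) K s d (phi d.1) (phi d.2).
have step s d : d \in E -> d \notin s ->
    `|Ex (fun=> p) (H (d :: s)) - Ex (fun=> p) (H s)| <= 4 * e.
  move=> dE ds; rewrite -ExB.
  (* Edges meeting [d.2] go into [B], the others into [A]. No edge of [B] meets [d.1]: it would be
     [d] or its reversal, and both are excluded. *)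
  pose P d' := (d'.1 == d.2) || (d'.2 == d.2).
  pose A (phi : {ffun I -> T}) :=
    \prod_(d' in E | (d' != d) && ~~ P d') K s d' (phi d'.1) (phi d'.2).
  pose B (phi : {ffun I -> T}) :=
    \prod_(d' in E | (d' != d) && P d') K s d' (phi d'.1) (phi d'.2).
  have HE phi : H (d :: s) phi - H s phi =
      (W1 (phi d.1) (phi d.2) - W2 (phi d.1) (phi d.2)) * (A phi * B phi).
    rewrite /H (bigD1 d) //= [X in _ - X](bigD1 d) //= /K inE eqxx (negbTE ds) /=.
    rewrite [X in _ * X - _](_ : _ = A phi * B phi).
      rewrite [X in _ - _ * X](_ : _ = A phi * B phi) ?mulrBl //.
      by rewrite (bigID P) /= mulrC; congr (_ * _); apply: eq_bigl => d' /=; rewrite -andbA.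
    rewrite (bigID P) /= mulrC; congr (_ * _); rewrite /A /B /K;
      apply: eq_big => d' /=; rewrite -?andbA //; move=> /and3P[_ dd _];
      by rewrite inE (negbTE dd).
  rewrite (eq_Ex _ HE).
  apply: (counting_edge We (Eirr d dE)) => [phi|phi|phi psi eqp|phi psi eqp].
  - by apply: norm_prod_le1 => *; apply: K1.
  - by apply: norm_prod_le1 => *; apply: K1.
  - apply: eq_bigr => d' /and3P[_ _]; rewrite negb_or => /andP[d1 d2].
    by rewrite !eqp.
  - apply: eq_bigr => -[a b] /and3P[abE abd]; rewrite /P /= => Pab.
    have [ad bd] : a != d.1 /\ b != d.1.
      have ji := Easym d dE; have dd := Eirr d dE.
      case/orP: Pab => /eqP E0; move: abE abd; rewrite E0 ![d.2 == _]eq_sym dd => abE abd.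
        by split=> //; apply: contraNneq ji => <-.
      by split=> //; apply: contraNneq abd => ->; rewrite -surjective_pairing.
    by rewrite !eqp.
have main s : uniq s -> {subset s <= E} ->
    `|Ex (fun=> p) (H s) - Ex (fun=> p) (H [::])| <= 4 * (size s)%:R * e.
  elim: s => [|d s IHs] /=; first by rewrite subrr normr0 mulr0 mul0r.
  case/andP=> ds us sE.
  have dE : d \in E by apply: sE; rewrite inE eqxx.
  have sE' : {subset s <= E} by move=> x xs; apply: sE; rewrite inE xs orbT.
  apply: (le_trans (ler_distD (Ex (fun=> p) (H s)) _ _)).
  have := IHs us sE'; have := step s d dE ds; rewrite -natr1; lra.
have := main (enum E) (enum_uniq _); rewrite -cardE => M.
have -> : Ex (fun=> p) (fun phi : {ffun I -> T} =>
    \prod_(d in E) W1 (phi d.1) (phi d.2)) = Ex (fun=> p) (H (enum E)).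
  by apply: eq_Ex => phi; apply: eq_bigr => d dE; rewrite /K mem_enum dE.
apply: M => d; by rewrite mem_enum.
Qed.

End Counting.

(** * Weak regularity *)

(* On classes of weight zero this is [x / 0 = 0]. *)
Definition cavg (R : numFieldType) (X D : finType) (q w : X -> R) (d : X -> D)
    (e : D) : R :=
  (\sum_(x | d x == e) q x * w x) / \sum_(x | d x == e) q x.

(** The squared L2 norm of the conditional expectation of [w] on the partition [d], the potential
    function of the Frieze-Kannan argument. *)
Definition energy (R : numFieldType) (X D : finType) (q w : X -> R)
    (d : X -> D) : R :=
  \sum_x q x * cavg q w d (d x) ^+ 2.

Section ConditionalAverage.
Variables (R : realFieldType) (X : finType) (q w : X -> R).
Hypothesis dq : is_dist q.

(** On each class [h] is constant and averaging preserves the weighted sum of [w]; a class of weight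
    zero adds 0 to both sides. This is the orthogonality behind the energy increment. *)
Lemma sum_cavg (D : finType) (d : X -> D) (h : D -> R) :
  \sum_x q x * (w x * h (d x)) = \sum_x q x * (cavg q w d (d x) * h (d x)).
Proof.
have [q0 _] := dq.
rewrite (partition_big d xpredT) //= [RHS](partition_big d xpredT) //=.
apply: eq_bigr => e _.
transitivity (h e * \sum_(x | d x == e) q x * w x).
  by rewrite mulr_sumr; apply: eq_bigr => x /eqP ->; ring.
transitivity (cavg q w d e * h e * \sum_(x | d x == e) q x); last first.
  by rewrite mulr_sumr; apply: eq_bigr => x /eqP ->; ring.
rewrite /cavg; set s := \sum_(x | d x == e) q x.
have [s0|s0] := eqVneq s 0; last by field.
rewrite s0 !mulr0 big1 ?mulr0 // => x dx.
by have /psumr_eq0P := s0; move=> -> //; rewrite mul0r.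
Qed.

Lemma cavg_bound (D : finType) (d : X -> D) M e :
  (forall x, `|w x| <= M) -> 0 <= M -> `|cavg q w d e| <= M.
Proof.
move=> wM M0; have [q0 _] := dq; rewrite /cavg; set s := \sum_(x | _) q x.
have s0 : 0 <= s by apply: sumr_ge0.
have [->|sN] := eqVneq s 0; first by rewrite invr0 mulr0 normr0.
rewrite normrM normfV [X in _ / X]ger0_norm // ler_pdivrMr ?lt_def ?sN //.
rewrite mulr_sumr; apply: (le_trans (ler_norm_sum _ _ _)); apply: ler_sum => x _.
by rewrite normrM [X in X * _]ger0_norm // mulrC ler_wpM2r.
Qed.

Lemma energy_le1 (D : finType) (d : X -> D) :
  (forall x, `|w x| <= 1) -> energy q w d <= 1.
Proof.
move=> w1; have [q0 <-] := dq; apply: ler_sum => x _.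
rewrite -[leRHS]mulr1 ler_wpM2l // -real_normK ?num_real //.
by rewrite expr_le1 // cavg_bound.
Qed.

(* By orthogonality the energy increment is the squared L2 distance of the two
   averages, to which Cauchy-Schwarz applies. *)
Lemma energy_increment (D D' : finType) (d : X -> D) (d' : X -> D')
    (r : D' -> D) (h : D' -> R) :
  (forall x, d x = r (d' x)) -> (forall x, 0 <= h (d' x) <= 1) ->
  (\sum_x q x * ((w x - cavg q w d (d x)) * h (d' x))) ^+ 2
  <= energy q w d' - energy q w d.
Proof.
move=> dr h01; have [q0 q1] := dq.
pose K x := cavg q w d (d x); pose K' x := cavg q w d' (d' x).
set t := \sum_x _.
have tE : t = \sum_x q x * ((K' x - K x) * h (d' x)).
  rewrite /t; under eq_bigr do rewrite mulrBl mulrBr.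
  under [RHS]eq_bigr do rewrite mulrBl mulrBr.
  by rewrite !sumrB sum_cavg.
clearbody t.
have KE : \sum_x q x * (K' x * K x) = energy q w d.
  transitivity (\sum_x q x * (w x * K x)).
    rewrite [RHS](eq_bigr (fun x => q x * (w x * cavg q w d (r (d' x))))).
      rewrite (sum_cavg d' (fun e => cavg q w d (r e))).
      by apply: eq_bigr => x _; rewrite /K dr.
    by move=> x _; rewrite /K dr.
  by rewrite (sum_cavg d (cavg q w d)); apply: eq_bigr => x _; rewrite expr2.
have -> : energy q w d' - energy q w d = \sum_x q x * (K' x - K x) ^+ 2.
  transitivity (energy q w d' - 2 * \sum_x q x * (K' x * K x) + energy q w d).
    by rewrite KE; ring.
  rewrite /energy mulr_sumr -sumrB -big_split; apply: eq_bigr => x _ /=.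
  by rewrite /K /K'; ring.
have h2 : \sum_x q x * h (d' x) ^+ 2 <= 1.
  rewrite -q1; apply: ler_sum => x _; rewrite -[leRHS]mulr1 ler_wpM2l //.
  by have /andP[? ?] := h01 x; rewrite expr_le1.
(* Cauchy-Schwarz: [t] is the inner product of [K' - K] and [h], so this square bounds the squared
   norm of [K' - K] below by [2 * t ^+ 2] minus [t ^+ 2] times that of [h], which is at most 1. *)
have : 0 <= \sum_x q x * (K' x - K x - t * h (d' x)) ^+ 2.
  by apply: sumr_ge0 => x _; rewrite mulr_ge0 ?sqr_ge0.
have -> : \sum_x q x * (K' x - K x - t * h (d' x)) ^+ 2 =
    \sum_x q x * (K' x - K x) ^+ 2 - 2 * t * t + t ^+ 2 * \sum_x q x * h (d' x) ^+ 2.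
  rewrite [X in _ - _ * X + _]tE !mulr_sumr -sumrB -big_split.
  by apply: eq_bigr => x _ /=; ring.
by have := sqr_ge0 t; nra.
Qed.

End ConditionalAverage.

Section WeakRegularity.
Variables (R : realFieldType) (V : finType) (p : V -> R) (W : V -> V -> R).
Hypotheses (dp : is_dist p) (W1 : forall x y, `|W x y| <= 1).

Let q (z : V * V) := p z.1 * p z.2.
Let w (z : V * V) := W z.1 z.2.
Let pairc (C : finType) (c : V -> C) (z : V * V) := (c z.1, c z.2).
Let K (C : finType) (c : V -> C) (i j : C) := cavg q w (pairc c) (i, j).

Let dq : is_dist q.
Proof.
have [p0 p1] := dp; split=> [z|]; first by rewrite mulr_ge0.
rewrite -(pair_bigA _ (fun x y => p x * p y)) /=.
by under eq_bigr do rewrite -mulr_sumr p1 mulr1.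
Qed.

(** Every class splits into at most four, hence the factor 4 per round in the number of classes. *)
Let refine (C : finType) (c : V -> C) (S S' : {set V}) x :=
  (c x, (x \in S, x \in S')).

Let energy_refine (C : finType) (c : V -> C) (S S' : {set V}) :
  (\sum_(x in S) \sum_(y in S') p x * p y * (W x y - K c (c x) (c y))) ^+ 2
  <= energy q w (pairc (refine c S S')) - energy q w (pairc c).
Proof.
pose r (e : (C * (bool * bool)) * (C * (bool * bool))) := (e.1.1, e.2.1).
pose h (e : (C * (bool * bool)) * (C * (bool * bool))) : R :=
  e.1.2.1%:R * e.2.2.2%:R.
have h01 z : 0 <= h (pairc (refine c S S') z) <= 1.
  by rewrite /h /=; do 2!case: (_ \in _); rewrite ?mulr1 ?mulr0 ?lexx ?ler01.
have := @energy_increment _ _ q w dq _ _ (pairc c) (pairc (refine c S S')) r h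
  (fun=> erefl) h01.
congr (_ ^+ 2 <= _); rewrite -bform_mem /bform pair_bigA.
by apply: eq_bigr => z _; rewrite -mulrA.
Qed.

(** Refining by a cut that deviates by more than [e] raises the energy by at least [e ^+ 2]. The
    induction on [r] therefore yields a good partition or an energy of at least [r%:R * e ^+ 2]. *)
Lemma weak_regularity (r : nat) (e : R) : 0 <= e -> 1 <= r%:R * e ^+ 2 ->
  exists (C : finType) (c : V -> C) (k : C -> C -> R),
    [/\ (#|C| <= 4 ^ r)%N, forall i j, `|k i j| <= 1
      & cut_le p (fun x y => W x y - k (c x) (c y)) e].
Proof.
move=> e0 re; have K1 (C : finType) (c : V -> C) i j : `|K c i j| <= 1.
  by apply: (cavg_bound dq) => // z; apply: W1.
have w1 z : `|w z| <= 1 by apply: W1.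
have : (exists (C : finType) (c : V -> C), (#|C| <= 4 ^ r)%N /\
      cut_le p (fun x y => W x y - K c (c x) (c y)) e) \/
    (exists (C : finType) (c : V -> C), (#|C| <= 4 ^ r)%N /\
      r%:R * e ^+ 2 <= energy q w (pairc c)).
  elim: r {re} => [|r [[C [c [Cr ce]]]|[C [c [Cr ce]]]]].
  - right; exists unit, (fun=> tt); rewrite card_unit mul0r; split=> //.
    by apply: sumr_ge0 => z _; rewrite mulr_ge0 ?sqr_ge0 //; case: dq.
  - left; exists C, c; split=> //; apply: (leq_trans Cr).
    by rewrite leq_exp2l.
  have [/forallP cut|] := boolP [forall S : {set V}, forall S' : {set V},
      `|\sum_(x in S) \sum_(y in S') p x * p y * (W x y - K c (c x) (c y))| <= e].
    left; exists C, c; split; first by apply: (leq_trans Cr); rewrite leq_exp2l.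
    by apply: cut_le_sets => S; apply/forallP.
  rewrite negb_forall => /existsP[S]; rewrite negb_forall => /existsP[S'].
  rewrite -ltNge => eS; right; exists (C * (bool * bool))%type, (refine c S S').
  split; first by rewrite !card_prod card_bool expnSr leq_mul2r Cr orbT.
  have := energy_refine c S S'; set t := \sum_(x in S) _ in eS *.
  have : e ^+ 2 <= t ^+ 2.
    by rewrite -[t ^+ 2]real_normK ?num_real // lerXn2r ?nnegrE // ltW.
  by rewrite -natr1; nra.
case=> [[C [c [Cr ce]]]|[C [c [Cr ce]]]]; exists C, c, (K c); split=> //.
(* The energy has reached its maximum 1, so a further refinement gains nothing and every cut
   deviates by 0. *)
apply: cut_le_sets => S S'; have := energy_refine c S S'.
set t := \sum_(x in S) _ => tE.
have : t ^+ 2 <= 0.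
  have := energy_le1 dq (pairc (refine c S S')) w1; lra.
by rewrite real_exprn_even_le0 ?num_real //= => /eqP ->; rewrite normr0.
Qed.

End WeakRegularity.

(** * Sampling a kernel of small cut norm *)

(** Not normalized: [cut_le_uniform] divides by the squared number of nodes. The base value 0 is
    harmless, the terms being nonnegative. *)
Definition cutn (R : numDomainType) (J : finType) (B : J -> J -> R) : R :=
  \big[Num.max/0]_(ST : {set J} * {set J})
    `|\sum_(i in ST.1) \sum_(j in ST.2) B i j|.

Section Sampling.
Variables (R : realFieldType) (J : finType).
Implicit Types B : J -> J -> R.

Lemma cutn_le B a : 0 <= a ->
  (forall S S' : {set J}, `|\sum_(i in S) \sum_(j in S') B i j| <= a) ->
  cutn B <= a.
Proof. by move=> a0 Ba; apply: bigmax_le => // -[S S'] _; apply: Ba. Qed.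

Lemma ler_cutn B (S S' : {set J}) :
  `|\sum_(i in S) \sum_(j in S') B i j| <= cutn B.
Proof. exact: (le_bigmax _ _ (S, S')). Qed.

Lemma cutn_ge0 B : 0 <= cutn B.
Proof. exact: bigmax_ge_id. Qed.

Let n : R := #|J|%:R.

Lemma sum_eq1 (a : J) : \sum_x (x == a)%:R = 1 :> R.
Proof.
by rewrite (bigD1 a) //= eqxx big1 ?addr0 // => x /negbTE ->.
Qed.

Lemma sum_1eq (a : J) : \sum_x (a == x)%:R = 1 :> R.
Proof. by under eq_bigr do rewrite eq_sym; exact: sum_eq1. Qed.

Lemma is_dist_uniform : (0 < #|J|)%N -> is_dist (fun _ : J => n^-1).
Proof.
move=> J0; split=> [_|]; first by rewrite invr_ge0 ler0n.
by rewrite sumr_const -[X in X = _]mulr_natl divff // pnatr_eq0 -lt0n.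
Qed.

(* Replacing a row sum [a] by the sign of its estimate [A] from a random sample
   costs at most the error of the estimate. *)
Lemma sign_estimate (s : bool) (a A : R) :
  s%:R * a <= (0 < A)%R%:R * a + `|a - A|.
Proof.
by case: ltP => A0; have := ler_norm (a - A); have := ler_norm (A - a);
  rewrite distrC; case: s; rewrite ?mul1r ?mul0r; lra.
Qed.

(** For fixed [T] the best rows are those with a positive row sum. Its sign is read off [q]
    uniformly sampled columns, and [sign_estimate] charges each row the expected error of the
    estimate. *)
Lemma subsample_rows (q : nat) (M d : R) B (S T : {set J}) :
  (0 < #|J|)%N -> 0 < M -> 0 < d -> 1 <= q%:R * d ^+ 2 ->
  (forall i j, `|B i j| <= M) ->
  \sum_(i in S) \sum_(j in T) B i j <=
  Ex (fun _ : 'I_q => fun=> n^-1) (fun z =>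
    \sum_(i in [set i | 0 < \sum_l (z l \in T)%:R * B i (z l)])
      \sum_(j in T) B i j) + n ^+ 2 * (M * d).
Proof.
move=> J0 M0 d0 qd BM; have du := is_dist_uniform J0; have du' := fun _ : 'I_q => du.
have n0 : 0 < n by rewrite ltr0n.
have q0 : 0 < q%:R :> R.
  by rewrite lt_def ler0n andbT; apply: contraTneq qd => ->; rewrite mul0r ler10.
pose a i := \sum_(j in T) B i j.
pose b i t := (t \in T)%:R * B i t - a i / n.
have aE i : \sum_t (t \in T)%:R * B i t = a i.
  by rewrite [RHS]big_mkcond; apply: eq_bigr => t _; case: ifP; rewrite ?mul1r ?mul0r.
have b0 i : \sum_t n^-1 * b i t = 0.
  rewrite -mulr_sumr sumrB aE sumr_const -mulr_natl -/n.
  by field; rewrite gt_eqF.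
have bM i : \sum_t n^-1 * b i t ^+ 2 <= M ^+ 2.
  have -> : \sum_t n^-1 * b i t ^+ 2 =
      n^-1 * (\sum_t ((t \in T)%:R * B i t) ^+ 2) - (a i / n) ^+ 2.
    rewrite -mulr_sumr; transitivity (n^-1 * (\sum_t ((t \in T)%:R * B i t) ^+ 2
       - 2 * (a i / n) * (\sum_t (t \in T)%:R * B i t) + n * (a i / n) ^+ 2)).
      congr (_ * _); rewrite /b; move: (a i / n) => c.
      rewrite /n -sumr_const mulr_suml mulr_sumr -sumrB -big_split.
      by apply: eq_bigr => t _ /=; ring.
    by rewrite aE; field; rewrite gt_eqF.
  have : n^-1 * (\sum_t ((t \in T)%:R * B i t) ^+ 2) <= M ^+ 2.
    rewrite mulrC ler_pdivrMr // mulr_natr -sumr_const; apply: ler_sum => t _.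
    rewrite -[leLHS]real_normK ?num_real // lerXn2r ?nnegrE ?(ltW M0) //.
    by case: (t \in T); rewrite ?mul1r ?mul0r ?normr0 ?(ltW M0).
  by have := sqr_ge0 (a i / n); lra.
have dev i : Ex (fun _ : 'I_q => fun=> n^-1)
    (fun z => `|n / q%:R * \sum_l b i (z l)|) <= n * (M * d).
  (* The sum of the [b i (z l)] has second moment at most [q%:R * M ^+ 2]; as [1 <= q%:R * d ^+ 2],
     this AM-GM parameter also bounds its mean absolute value. *)
  have c0 : 0 < q%:R * M * d by rewrite !mulr_gt0.
  apply: (@le_trans _ _ (n / q%:R * ((q%:R * M ^+ 2 / (q%:R * M * d) + q%:R * M * d) / 2))).
    under eq_Ex do rewrite normrM ger0_norm ?ltW ?divr_gt0 //.
    rewrite ExZ ler_pM2l ?divr_gt0 //.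
    apply: (le_trans (Ex_amgm _ du' c0)).
    rewrite Ex_sum_var // card_ord ler_pM2r ?invr_gt0 ?ltr0n // lerD2r.
    by rewrite ler_pM2r ?invr_gt0 // ler_pM2l.
  have -> : n / q%:R * ((q%:R * M ^+ 2 / (q%:R * M * d) + q%:R * M * d) / 2)
      = n * M * ((1 + q%:R * d ^+ 2) / (2 * (q%:R * d))).
    by field; rewrite !gt_eqF.
  rewrite [leRHS]mulrA ler_pM2l ?mulr_gt0 // ler_pdivrMr ?mulr_gt0 // ?ltr0n //.
  by nra.
have -> : \sum_(i in S) a i =
    \sum_i Ex (fun _ : 'I_q => fun _ : J => n^-1) (fun=> (i \in S)%:R * a i).
  rewrite big_mkcond; apply: eq_bigr => i _; rewrite Ex_cst //.
  by case: ifP; rewrite ?mul1r ?mul0r.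
have -> : n ^+ 2 * (M * d) = \sum_(i : J) n * (M * d).
  by rewrite sumr_const -[RHS]mulr_natl -/n; ring.
apply: (@le_trans _ _ (\sum_i (Ex (fun _ : 'I_q => fun=> n^-1)
   (fun z => (0 < \sum_l (z l \in T)%:R * B i (z l))%R%:R * a i) + n * (M * d)))).
  apply: ler_sum => i _; apply: le_trans (lerD (lexx _) (dev i)).
  rewrite -ExD; apply: (le_Ex du') => z.
  set A := \sum_l (z l \in T)%:R * B i (z l).
  have bA : \sum_l b i (z l) = A - q%:R * (a i / n).
    by rewrite sumrB sumr_const card_ord -[X in _ - X]mulr_natl.
  have := sign_estimate (i \in S) (a i) (n / q%:R * A).
  rewrite pmulr_rgt0 ?divr_gt0 // bA -normrN; congr (_ <= _ + `|_|).
  by field; rewrite !gt_eqF.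
rewrite big_split lerD2r -Ex_sum /=; apply: (le_Ex du') => z.
rewrite [leRHS]big_mkcond; apply: ler_sum => i _; rewrite inE.
by case: ifP; rewrite ?mul1r ?mul0r.
Qed.

End Sampling.

Section CutSampling.
Variables (R : realFieldType) (J V : finType) (p : V -> R).
Hypothesis dp : is_dist p.

Let n : R := #|J|%:R.
Let dp' := fun _ : J => dp.

(** The square expands into a sum over quadruples. If [i != j] and both differ from [k] and [l],
    independence makes the term vanish; [ind] counts the five coincidences that spoil this, each
    true of [n ^+ 3] quadruples. *)
Lemma Ex_sum2_centered (g : V -> V -> R) (B : R) :
  (forall u v, `|g u v| <= B) -> \sum_u \sum_v p u * p v * g u v = 0 ->
  Ex (fun _ : J => p) (fun y => (\sum_i \sum_j g (y i) (y j)) ^+ 2)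
  <= 5 * B ^+ 2 * n ^+ 3.
Proof.
move=> gB g0.
pose ind (i j k l : J) : R := (i == j)%:R + (i == k)%:R + (i == l)%:R
  + (j == k)%:R + (j == l)%:R.
have B0 (x : {ffun J -> V}) (i : J) : 0 <= B.
  exact: le_trans (normr_ge0 _) (gB (x i) (x i)).
have ind0 (i j k l : J) b : 0 <= (b : bool)%:R :> R by rewrite ler0n.
have term i j k l : Ex (fun=> p) (fun y : {ffun J -> V} => g (y i) (y j) * g (y k) (y l))
    <= B ^+ 2 * ind i j k l.
  have triv : 1 <= ind i j k l ->
      Ex (fun=> p) (fun y : {ffun J -> V} => g (y i) (y j) * g (y k) (y l))
      <= B ^+ 2 * ind i j k l.
    move=> ind1; apply: (Ex_le dp') => y; apply: (le_trans (ler_norm _)).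
    have : `|g (y i) (y j) * g (y k) (y l)| <= B ^+ 2.
      by rewrite normrM expr2 ler_pM.
    by move=> /le_trans; apply; rewrite ler_peMr // exprn_ge0 // (B0 y i).
  have [ij|ij] := boolP (i == j).
    by apply: triv; rewrite /ind ij -!addrA lerDl !addr_ge0.
  have [dis|] := boolP [&& i != k, i != l, j != k & j != l]; last first.
    move=> dis; apply: triv; rewrite /ind -!natrD ler1n; move: dis.
    by case: (i == j); case: (i == k); case: (i == l); case: (j == k); case: (j == l).
  have -> : ind i j k l = 0.
    move: dis => /and4P[/negbTE d1 /negbTE d2 /negbTE d3 /negbTE d4].
    by rewrite /ind (negbTE ij) d1 d2 d3 d4 !addr0.
  rewrite mulr0 (@Ex_indep _ _ _ _ dp' [set i; j]
    (fun y => g (y i) (y j)) (fun y => g (y k) (y l))).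
  - by rewrite (Ex_marg2 dp' g ij) g0 mul0r.
  - by move=> x y; rewrite !ffunE !inE !eqxx orbT.
  move: dis => /and4P[d1 d2 d3 d4] x y; rewrite !ffunE !inE ![k == _]eq_sym ![l == _]eq_sym.
  by rewrite (negbTE d1) (negbTE d2) (negbTE d3) (negbTE d4).
apply: (@le_trans _ _ (\sum_i \sum_j \sum_k \sum_l B ^+ 2 * ind i j k l)).
  have sqE (y : {ffun J -> V}) : (\sum_i \sum_j g (y i) (y j)) ^+ 2 =
      \sum_i \sum_j \sum_k \sum_l g (y i) (y j) * g (y k) (y l).
    rewrite expr2 mulr_suml; apply: eq_bigr => i _.
    rewrite mulr_suml; apply: eq_bigr => j _.
    by rewrite mulr_sumr; apply: eq_bigr => k _; rewrite mulr_sumr.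
  rewrite (eq_Ex _ sqE) Ex_sum; apply: ler_sum => i _ /=.
  rewrite Ex_sum; apply: ler_sum => j _ /=.
  rewrite Ex_sum; apply: ler_sum => k _ /=.
  by rewrite Ex_sum; apply: ler_sum => l _.
apply: eq_ler; under eq_bigr do under eq_bigr do under eq_bigr do rewrite -mulr_sumr.
under eq_bigr do under eq_bigr do rewrite -mulr_sumr.
under eq_bigr do rewrite -mulr_sumr; rewrite -mulr_sumr.
have sumc c : \sum_(x : J) c = n * c by rewrite sumr_const -[LHS]mulr_natl.
have E (i j k : J) : \sum_l ind i j k l =
    n * (i == j)%:R + n * (i == k)%:R + n * (j == k)%:R + 2.
  by rewrite !big_split /= !sum_1eq !sumc; ring.
under eq_bigr do under eq_bigr do under eq_bigr do rewrite E.
have E2 (i j : J) : \sum_k (n * (i == j)%:R + n * (i == k)%:R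
    + n * (j == k)%:R + 2) = n ^+ 2 * (i == j)%:R + 4 * n.
  by rewrite !big_split /= -!mulr_sumr !sum_1eq !sumc; ring.
under eq_bigr do under eq_bigr do rewrite E2.
have E3 (i : J) : \sum_j (n ^+ 2 * (i == j)%:R + 4 * n) = 5 * n ^+ 2.
  by rewrite !big_split /= -!mulr_sumr !sum_1eq !sumc; ring.
under eq_bigr do rewrite E3.
by rewrite sumc; ring.
Qed.

Variables (U : V -> V -> R) (M e : R) (q : nat).
Hypotheses (M0 : 0 < M) (UM : forall u v, `|U u v| <= M) (Ue : cut_le p U e).

Implicit Types (x y : {ffun J -> V}) (z : {ffun 'I_q -> J}).
Implicit Types (rho : {ffun 'I_q -> bool}).

(* The rows, resp. columns, that a subsample with indices [z] and pattern [rho]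
   selects; the sign [b] serves to bound the cut norm from both sides. *)
Let row_test x z (b : bool) rho (v : V) : bool :=
  0 < \sum_l (rho l)%:R * ((-1) ^+ b * U v (x (z l))).
Let col_test x z (b : bool) rho (v : V) : bool :=
  0 < \sum_l (rho l)%:R * ((-1) ^+ b * U (x (z l)) v).

Let pattern := (bool * {ffun 'I_q -> bool} * {ffun 'I_q -> bool})%type.

(** The tests are put to nodes of [V] rather than to indices, so once the subsample is known this is
    a fixed kernel on [V]. *)
Let kernel x z z' (w : pattern) u v : R :=
  U u v * ((row_test x z w.1.1 w.1.2 u)%:R * (col_test x z' w.1.1 w.2 v)%:R).

Let sampled x z z' : R :=
  \big[Num.max/0]_(w : pattern)
    `|\sum_i \sum_j kernel x z z' w (x i) (x j)|.

Lemma norm_signM (b : bool) (a : R) : `|(-1) ^+ b * a| = `|a|.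
Proof. by rewrite normrM normrX normrN1 expr1n mul1r. Qed.

(** Two rounds of [subsample_rows], for rows and then for columns, replace arbitrary sets by
    selected ones. These depend on the original sets only through a pattern, so the maximum over
    patterns covers all of them. *)
Let cutn_sampled x (d : R) : (0 < #|J|)%N -> 0 < d -> 1 <= q%:R * d ^+ 2 ->
  cutn (fun i j => U (x i) (x j)) <=
  Ex (fun _ : 'I_q => fun=> n^-1) (fun z =>
    Ex (fun _ : 'I_q => fun=> n^-1) (fun z' => sampled x z z'))
  + 2 * n ^+ 2 * (M * d).
Proof.
move=> J0 d0 qd; have du' := fun _ : 'I_q => is_dist_uniform R J0.
have S0 z z' : 0 <= sampled x z z' by exact: bigmax_ge_id.
have one (b : bool) (S T : {set J}) :
    \sum_(i in S) \sum_(j in T) (-1) ^+ b * U (x i) (x j) <=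
    Ex (fun _ : 'I_q => fun=> n^-1) (fun z =>
      Ex (fun _ : 'I_q => fun=> n^-1) (fun z' => sampled x z z'))
    + 2 * n ^+ 2 * (M * d).
  pose B i j := (-1) ^+ b * U (x i) (x j).
  have BM i j : `|B i j| <= M by rewrite norm_signM.
  apply: (le_trans (subsample_rows S T J0 M0 d0 qd BM)).
  have -> : 2 * n ^+ 2 * (M * d) = n ^+ 2 * (M * d) + n ^+ 2 * (M * d) by ring.
  rewrite addrA lerD2r -[X in _ <= _ + X](Ex_cst du') -ExD; apply: (le_Ex du') => z.
  set S' := [set i | _]; rewrite exchange_big /=.
  apply: (le_trans (subsample_rows T S' J0 M0 d0 qd (fun i j => BM j i))).
  rewrite lerD2r; apply: (le_Ex du') => z'.
  set T' := [set i | _]; rewrite exchange_big /=.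
  pose w : pattern := (b, [ffun l => z l \in T], [ffun l => z' l \in S']).
  rewrite [leLHS](_ : _ = (-1) ^+ b * \sum_i \sum_j kernel x z z' w (x i) (x j)).
    apply: (le_trans (ler_norm _)); rewrite norm_signM.
    exact: (le_bigmax _ (fun w => `|\sum_i \sum_j kernel x z z' w (x i) (x j)|) w).
  have rowE i : row_test x z b [ffun l => z l \in T] (x i) = (i \in S').
    by rewrite inE /row_test; under eq_bigr do rewrite ffunE.
  have colE j : col_test x z' b [ffun l => z' l \in S'] (x j) = (j \in T').
    by rewrite inE /col_test; under eq_bigr do rewrite ffunE.
  rewrite mulr_sumr [LHS]big_mkcond; apply: eq_bigr => i _.
  rewrite mulr_sumr; case: (boolP (i \in S')) => iS'; last first.
    by rewrite big1 // => j _; rewrite /kernel rowE (negbTE iS') mul0r !mulr0.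
  rewrite [LHS]big_mkcond; apply: eq_bigr => j _.
  rewrite /kernel rowE colE iS' mul1r /B.
  by case: (j \in T'); rewrite ?mulr1 ?mulr0.
apply: cutn_le => [|S T].
  rewrite addr_ge0 //.
    by apply: (Ex_ge0 du') => z; apply: (Ex_ge0 du') => z'.
  by rewrite !mulr_ge0 ?sqr_ge0 ?(ltW M0) ?(ltW d0).
rewrite ler_norml; apply/andP; split.
  rewrite lerNl; apply: le_trans (one true S T); rewrite -sumrN.
  apply: ler_sum => i _; rewrite -sumrN; apply: ler_sum => j _.
  by rewrite expr1 mulN1r.
apply: le_trans (one false S T).
by apply: ler_sum => i _; apply: ler_sum => j _; rewrite expr0 mul1r.
Qed.

(** Given the coordinates in the subsample [A], the tests are fixed and the other coordinates stay
    independent. The three terms are the mean, the cost of the at most [2 * q] rows and columns in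
    [A], and the fluctuation. *)
Let sampled_mean z z' (c : R) : 0 < c ->
  Ex (fun _ : J => p) (fun x => sampled x z z') <=
  n ^+ 2 * e + 8 * q%:R * M * n
  + ((2 * 4 ^+ q) * (20 * M ^+ 2 * n ^+ 3) / c + c) / 2.
Proof.
move=> c0; pose A := [set z l | l : 'I_q] :|: [set z' l | l : 'I_q].
rewrite (Ex_mix dp' A); apply: (Ex_le dp') => x.
pose mu w := bform p U (fun u => (row_test x z w.1.1 w.1.2 u)%:R)
                       (fun v => (col_test x z' w.1.1 w.2 v)%:R).
pose fl (w : pattern) y := \sum_i \sum_j (kernel x z z' w (y i) (y j) - mu w).
have kM w u v : `|kernel x z z' w u v| <= M.
  rewrite normrM -[leRHS]mulr1 ler_pM //.
  by rewrite -natrM mulnb normr_nat lern1 leq_b1.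
have mue w : `|mu w| <= e by apply: Ue; exact: unit_fun_mem.
have muM w : `|mu w| <= M.
  by apply: (cut_le_bound dp UM); exact: unit_fun_mem.
have e0 : 0 <= e by exact: le_trans (normr_ge0 _) (mue (true, [ffun=> true], [ffun=> true])).
have Acard : (#|A| <= q + q)%N.
  apply: (leq_trans (leq_card_setU _ _)).
  by apply: leq_add; rewrite (leq_trans (leq_imset_card _ _)) // card_ord.
have mixz y l : mix A x y (z l) = x (z l).
  by rewrite ffunE inE imset_f.
have mixz' y l : mix A x y (z' l) = x (z' l).
  by rewrite ffunE inE [X in _ || X]imset_f ?orbT.
have mixk y w u v : kernel (mix A x y) z z' w u v = kernel x z z' w u v.
  have rowE : row_test (mix A x y) z w.1.1 w.1.2 u = row_test x z w.1.1 w.1.2 u.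
    by rewrite /row_test; under eq_bigr do rewrite mixz.
  have colE : col_test (mix A x y) z' w.1.1 w.2 v = col_test x z' w.1.1 w.2 v.
    by rewrite /col_test; under eq_bigr do rewrite mixz'.
  by rewrite /kernel rowE colE.
have pointwise y : sampled (mix A x y) z z' <=
    n ^+ 2 * e + 8 * q%:R * M * n + (\sum_w fl w y ^+ 2 / c + c) / 2.
  have pos : 0 <= \sum_w fl w y ^+ 2 / c.
    by apply: sumr_ge0 => w _; rewrite divr_ge0 ?sqr_ge0 ?ltW.
  have n0 : 0 <= n by rewrite ler0n.
  apply: bigmax_le => [|w _].
    by rewrite !(addr_ge0, mulr_ge0) ?invr_ge0 ?sqr_ge0 ?ler0n ?(ltW M0) ?(ltW c0).
  under eq_bigr do under eq_bigr do rewrite mixk.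
  set s := \sum_i _.
  (* Comparison with the fully independent draw [y], in which the coordinates in [A] are sampled
     afresh. *)
  have -> : s = (s - \sum_i \sum_j kernel x z z' w (y i) (y j)) + (n ^+ 2 * mu w + fl w y).
    have -> : fl w y = \sum_i \sum_j kernel x z z' w (y i) (y j) - n ^+ 2 * mu w.
      rewrite /fl; under eq_bigr do rewrite sumrB sumr_const.
      by rewrite sumrB sumr_const /n -natrX -mulrnA mulr_natl.
    by ring.
  apply: (le_trans (ler_normD _ _)); rewrite -addrA addrCA lerD //.
    rewrite /s -sumrB; apply: (le_trans (ler_norm_sum _ _ _)).
    apply: (@le_trans _ _ (\sum_i \sum_j 2 * M * ((i \in A)%:R + (j \in A)%:R))).
      apply: ler_sum => i _; rewrite -sumrB.
      apply: (le_trans (ler_norm_sum _ _ _)); apply: ler_sum => j _.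
      have dM u v u' v' : `|kernel x z z' w u v - kernel x z z' w u' v'| <= 2 * M.
        by apply: (le_trans (ler_normB _ _)); have := kM w u v; have := kM w u' v'; lra.
      rewrite !ffunE -natrD; have [iA|jA] := boolP ((i \in A) || (j \in A)).
        apply: (le_trans (dM _ _ _ _)); rewrite ler_peMr ?mulr_ge0 ?ler0n ?(ltW M0) // ler1n.
        by case: (i \in A) iA; case: (j \in A).
      move: jA; rewrite negb_or => /andP[/negbTE -> /negbTE ->].
      by rewrite subrr normr0 mulr0.
    have sumA : \sum_(j : J) (j \in A)%:R = #|A|%:R :> R.
      rewrite -sum1_card natr_sum [RHS]big_mkcond.
      by apply: eq_bigr => j _; case: (j \in A).
    have sumc a : \sum_(j : J) a = n * a by rewrite sumr_const -[LHS]mulr_natl.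
    under eq_bigr do rewrite -mulr_sumr big_split /= sumc sumA.
    rewrite -mulr_sumr big_split /= -mulr_sumr sumA sumc.
    have : #|A|%:R <= 2 * q%:R :> R by rewrite -natrM ler_nat mul2n -addnn.
    move: (#|A|%:R) => a a2.
    have Mn0 : 0 <= M * n by rewrite mulr_ge0 // ltW.
    by have := ler_wpM2l Mn0 a2; lra.
  apply: (le_trans (ler_normD _ _)); rewrite lerD //.
    by rewrite normrM ger0_norm ?sqr_ge0 // ler_wpM2l ?sqr_ge0.
  apply: (le_trans (amgm_norm _ c0)).
  rewrite ler_pM2r ?invr_gt0 ?ltr0n // lerD2r.
  (* The union bound: one square is at most the sum of the squares over all patterns. *)
  rewrite (bigD1 w) //= lerDl sumr_ge0 // => w' _.
  by rewrite divr_ge0 ?sqr_ge0 ?ltW.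
apply: (le_trans (le_Ex dp' pointwise)).
have E y : n ^+ 2 * e + 8 * q%:R * M * n + (\sum_w fl w y ^+ 2 / c + c) / 2 =
    (n ^+ 2 * e + 8 * q%:R * M * n + c / 2) + (2 * c)^-1 * \sum_w fl w y ^+ 2.
  rewrite -mulr_suml; field; by rewrite gt_eqF.
rewrite (eq_Ex _ E) ExD Ex_cst // ExZ Ex_sum.
have fl2 w : Ex (fun=> p) (fun y => fl w y ^+ 2) <= 20 * M ^+ 2 * n ^+ 3.
  have -> : 20 * M ^+ 2 * n ^+ 3 = 5 * (2 * M) ^+ 2 * n ^+ 3 by ring.
  apply: (Ex_sum2_centered (g := fun u v => kernel x z z' w u v - mu w)) => [u v|].
    apply: (le_trans (ler_normB _ _)); have := kM w u v; have := muM w; lra.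
  under eq_bigr do under eq_bigr do rewrite mulrBr.
  have [_ p1] := dp; under eq_bigr do rewrite sumrB -mulr_suml -mulr_sumr p1 mulr1.
  rewrite sumrB -mulr_suml p1 mul1r.
  apply/eqP; rewrite subr_eq0; apply/eqP; apply: eq_bigr => u _.
  by apply: eq_bigr => v _; rewrite /kernel -[RHS]mulrA.
have : \sum_w Ex (fun=> p) (fun y => fl w y ^+ 2) <= 2 * 4 ^+ q * (20 * M ^+ 2 * n ^+ 3).
  apply: (@le_trans _ _ (\sum_(w : pattern) 20 * M ^+ 2 * n ^+ 3)); first exact: ler_sum.
  rewrite sumr_const -[leLHS]mulr_natl; apply: eq_ler; congr (_ * _).
  rewrite !card_prod card_bool !card_ffun card_bool card_ord !natrM -mulrA -natrM.
  by rewrite -expnMn natrX.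
set s := \sum_w _ => sle.
set t := 2 * 4 ^+ q * _; have -> : (t / c + c) / 2 = c / 2 + (2 * c)^-1 * t.
  by field; rewrite gt_eqF.
by rewrite [leRHS]addrA lerD2l ler_pM2l // invr_gt0 mulr_gt0.
Qed.

(** The subsample indices are independent of [x], so they can be fixed first and [sampled_mean]
    applied. *)
Lemma cut_sampling (d c : R) : (0 < #|J|)%N -> 0 < d -> 1 <= q%:R * d ^+ 2 -> 0 < c ->
  Ex (fun _ : J => p) (fun x => cutn (fun i j => U (x i) (x j))) <=
  n ^+ 2 * e + 8 * q%:R * M * n
  + ((2 * 4 ^+ q) * (20 * M ^+ 2 * n ^+ 3) / c + c) / 2
  + 2 * n ^+ 2 * (M * d).
Proof.
move=> J0 d0 qd c0; have du' := fun _ : 'I_q => is_dist_uniform R J0.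
apply: (le_trans (le_Ex dp' (fun x => cutn_sampled x J0 d0 qd))).
rewrite ExD Ex_cst // lerD2r Ex_exchange; apply: (Ex_le du') => z.
by rewrite Ex_exchange; apply: (Ex_le du') => z'; apply: sampled_mean.
Qed.

End CutSampling.

(** * Random signs *)

Definition before (J : finType) (i j : J) : bool :=
  (enum_rank i < enum_rank j)%N.

Definition upair (J : finType) (i j : J) : J * J :=
  if before i j then (i, j) else (j, i).

(* The entry [false] of a sign pattern stands for [1], and [true] for [-1]. *)
Definition sign_mx (R : pzRingType) (J : finType) (s : {ffun J * J -> bool})
    (i j : J) : R :=
  if i == j then 0 else (-1) ^+ s (upair i j).

(* The law of independent signs with mean [B i j] at the pair [(i, j)], [i]
   before [j]; the other pairs carry unused fair signs. *)
Definition sign_law (R : fieldType) (J : finType) (B : J -> J -> R)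
    (d : J * J) (b : bool) : R :=
  if before d.1 d.2 then (1 + (-1) ^+ b * B d.1 d.2) / 2 else 2^-1.

Section Noise.
Variables (R : realFieldType) (J : finType) (B : J -> J -> R).
Hypotheses (B1 : forall i j, `|B i j| <= 1) (Bsym : forall i j, B i j = B j i).

Let n : R := #|J|%:R.

Lemma before_total (i j : J) : i != j -> before j i = ~~ before i j.
Proof.
move=> ij; rewrite /before -leqNgt ltn_neqAle; case: eqVneq => //= E.
by move: ij; rewrite (enum_rank_inj (val_inj E)) eqxx.
Qed.

Lemma before_upair (i j : J) : i != j -> before (upair i j).1 (upair i j).2.
Proof.
by move=> ij; rewrite /upair; case: ifP => //= /negbT; rewrite -before_total.
Qed.

Lemma upair_inj (i j i' j' : J) : upair i j = upair i' j' ->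
  (i = i' /\ j = j') \/ (i = j' /\ j = i').
Proof.
by rewrite /upair; case: ifP => _; case: ifP => _ [-> ->]; [left|right|right|left].
Qed.

Lemma is_dist_sign_law d : is_dist (sign_law B d).
Proof.
have := B1 d.1 d.2; rewrite ler_norml => /andP[b1 b2].
split=> [b|]; rewrite /sign_law.
  by case: ifP; case: b => _; rewrite ?expr1 ?expr0; lra.
by rewrite big_bool /= expr1 expr0; case: ifP => _; field.
Qed.

Let ds := is_dist_sign_law.

Let dev (d : J * J) (b : bool) : R := (-1) ^+ b - B d.1 d.2.

Definition noise (s : {ffun J * J -> bool}) (i j : J) : R :=
  if i == j then 0 else sign_mx R s i j - B i j.

Lemma noiseE s i j : i != j -> noise s i j = dev (upair i j) (s (upair i j)).
Proof.
move=> ij; rewrite /noise /sign_mx (negbTE ij) /dev /upair.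
by case: ifP => _ //=; rewrite [B i j]Bsym.
Qed.

Lemma noise_le2 s i j : `|noise s i j| <= 2.
Proof.
rewrite /noise; case: ifP => _; first by rewrite normr0.
apply: (le_trans (ler_normB _ _)). rewrite /sign_mx.
case: ifP => _; first by rewrite normr0; have := B1 i j; lra.
by rewrite normrX normrN1 expr1n; have := B1 i j; lra.
Qed.

Lemma sign_law_mean d : before d.1 d.2 -> \sum_b sign_law B d b * dev d b = 0.
Proof.
by move=> bd; rewrite big_bool /= /sign_law bd /dev expr1 expr0; field.
Qed.

Let corr s (j j' : J) : R := \sum_i noise s i j * noise s i j'.

(** For [i != i'] either a factor lies on the diagonal and is 0, or the entry at [i], [j] is
    centered and independent of the other three. Each of the [n] terms with [i = i'] is at most
    [2 ^ 4]. *)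
Lemma Ex_corr2 (j j' : J) : j != j' ->
  Ex (sign_law B) (fun s => corr s j j' ^+ 2) <= 16 * n.
Proof.
move=> jj.
have E s : corr s j j' ^+ 2 = \sum_i \sum_i'
    noise s i j * (noise s i j' * (noise s i' j * noise s i' j')).
  rewrite expr2 big_distrlr; apply: eq_bigr => i _; apply: eq_bigr => i' _ /=.
  by rewrite -mulrA.
rewrite (eq_Ex _ E) Ex_sum /n -sum1_card natr_sum mulr_sumr.
apply: ler_sum => i _ /=; rewrite mulr1 Ex_sum (bigD1 i) //=.
rewrite [X in _ + X]big1 ?addr0 => [|i' i'i].
  apply: (Ex_le ds) => s; apply: (le_trans (ler_norm _)); rewrite !normrM.
  have -> : 16 = 2 * (2 * (2 * 2)) :> R by ring.
  by do 3!(apply: ler_pM; rewrite ?mulr_ge0 ?noise_le2 //).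
have nz0 (F : {ffun J * J -> bool} -> R) : (forall s, F s = 0) -> Ex (sign_law B) F = 0.
  by move=> F0; rewrite (eq_Ex _ F0) Ex_cst.
have n0 s l : noise s l l = 0 by rewrite /noise eqxx.
have [<-|ij] := eqVneq i j; first by apply: nz0 => s; rewrite n0 mul0r.
have [<-|ij'] := eqVneq i j'; first by apply: nz0 => s; rewrite n0 mul0r mulr0.
have [<-|i'j] := eqVneq i' j; first by apply: nz0 => s; rewrite n0 mul0r !mulr0.
have [<-|i'j'] := eqVneq i' j'; first by apply: nz0 => s; rewrite n0 !mulr0.
rewrite (@Ex_indep _ _ _ _ ds [set upair i j] (fun s => noise s i j)
  (fun s => noise s i j' * (noise s i' j * noise s i' j'))).
- under eq_Ex do rewrite noiseE //.
  rewrite (Ex_marg1 ds (upair i j) (dev (upair i j))) sign_law_mean ?mul0r //.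
  exact: before_upair.
- by move=> s t; rewrite !noiseE // ffunE inE eqxx.
move=> s t; rewrite !noiseE // !ffunE !inE.
have -> : (upair i j' == upair i j) = false.
  by apply/eqP => /upair_inj[[_ E']|[E' _]]; [rewrite E' eqxx in jj|rewrite E' eqxx in ij].
have -> : (upair i' j == upair i j) = false.
  by apply/eqP => /upair_inj[[E' _]|[E' _]]; [rewrite E' eqxx in i'i|rewrite E' eqxx in i'j].
suff -> : (upair i' j' == upair i j) = false by [].
apply/eqP => /upair_inj[[E' _]|[_ E']]; first by rewrite E' eqxx in i'i.
by rewrite E' eqxx in ij'.
Qed.

(* Two applications of Cauchy-Schwarz bound the cut norm by the correlations of
   pairs of columns, whose second moments are small. *)
Lemma Ex_cutn_noise (c c' : R) : 0 < c -> 0 < c' ->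
  Ex (sign_law B) (fun s => cutn (noise s)) <=
  ((4 * n ^+ 2 + n ^+ 2 * ((16 * n / c' + c') / 2)) / c + n * c) / 2.
Proof.
move=> c0 c'0.
have n0 : 0 <= n by rewrite ler0n.
have sumc a : \sum_(j : J) a = n * a by rewrite sumr_const -[LHS]mulr_natl.
have cut s : cutn (noise s) <= ((\sum_j \sum_j' `|corr s j j'|) / c + n * c) / 2.
  have C0 : 0 <= \sum_j \sum_j' `|corr s j j'|.
    by apply: sumr_ge0 => j _; apply: sumr_ge0.
  apply: cutn_le => [|S T].
    by rewrite !(addr_ge0, mulr_ge0) ?invr_ge0 ?(ltW c0).
  pose r i := \sum_(j in T) noise s i j.
  apply: (@le_trans _ _ (\sum_i `|r i|)).
    apply: (le_trans (ler_norm_sum _ _ _)).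
    by rewrite [leLHS]big_mkcond; apply: ler_sum => i _; case: ifP.
  apply: (@le_trans _ _ (\sum_i (r i ^+ 2 / c + c) / 2)).
    by apply: ler_sum => i _; apply: amgm_norm.
  rewrite -mulr_suml ler_pM2r ?invr_gt0 ?ltr0n // big_split /= sumc lerD2r.
  rewrite -mulr_suml ler_pM2r ?invr_gt0 //.
  have -> : \sum_i r i ^+ 2 = \sum_(j in T) \sum_(j' in T) corr s j j'.
    under [RHS]eq_bigr do rewrite exchange_big.
    rewrite [RHS]exchange_big /=; apply: eq_bigr => i _.
    by rewrite expr2 big_distrlr.
  rewrite [leLHS]big_mkcond; apply: ler_sum => j _; case: ifP => _; last exact: sumr_ge0.
  rewrite [leLHS]big_mkcond; apply: ler_sum => j' _; case: ifP => _ //.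
  exact: ler_norm.
apply: (le_trans (le_Ex ds cut)).
have E s : ((\sum_j \sum_j' `|corr s j j'|) / c + n * c) / 2 =
    n * c / 2 + (2 * c)^-1 * \sum_j \sum_j' `|corr s j j'|.
  by field; rewrite gt_eqF.
rewrite (eq_Ex _ E) ExD Ex_cst // ExZ Ex_sum.
set X := 4 * n ^+ 2 + _; have -> : (X / c + n * c) / 2 = n * c / 2 + (2 * c)^-1 * X.
  by field; rewrite gt_eqF.
rewrite lerD2l ler_pM2l ?invr_gt0 ?mulr_gt0 //.
pose b := (16 * n / c' + c') / 2.
have b0 : 0 <= b by rewrite !(addr_ge0, mulr_ge0) ?invr_ge0 ?(ltW c'0).
(* A column with itself gets the trivial bound; distinct columns get [b] from [Ex_corr2] and AM-GM
   at [c']. *)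
apply: (@le_trans _ _ (\sum_j \sum_j' (4 * n * (j == j')%:R + b))).
  apply: ler_sum => j _; rewrite Ex_sum; apply: ler_sum => j' _.
  have [<-|jj] := eqVneq j j'.
    rewrite mulr1; apply: le_trans (_ : 4 * n <= _); last by rewrite lerDl.
    apply: (Ex_le ds) => s; apply: (le_trans (ler_norm_sum _ _ _)).
    rewrite mulrC -sumc; apply: ler_sum => i _; rewrite normrM.
    have -> : 4 = 2 * 2 :> R by ring.
    by rewrite ler_pM ?noise_le2.
  rewrite mulr0 add0r; apply: (le_trans (Ex_amgm _ ds c'0)).
  rewrite /b ler_pM2r ?invr_gt0 ?ltr0n // lerD2r ler_pM2r ?invr_gt0 //.
  exact: Ex_corr2.
apply: eq_ler; rewrite /X -/b.
under eq_bigr do rewrite big_split /= -mulr_sumr sum_1eq mulr1 sumc.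
by rewrite sumc; ring.
Qed.

End Noise.

(** * Couplings *)

Definition coupling (R : numDomainType) (A B : finType) (p : A -> R)
    (p' : B -> R) (X : A -> B -> R) : Prop :=
  [/\ forall a b, 0 <= X a b, forall a, \sum_b X a b = p a
    & forall b, \sum_a X a b = p' b].

Section CutTransport.
Variable R : realFieldType.

Lemma eq_cut_le (T : finType) (p : T -> R) (U U' : T -> T -> R) e :
  (forall x y, U x y = U' x y) -> cut_le p U e -> cut_le p U' e.
Proof.
move=> UU Ue f g f01 g01.
by rewrite -(eq_bform p UU (frefl f) (frefl g)); apply: Ue.
Qed.

Lemma cut_leD (T : finType) (p : T -> R) (U U' : T -> T -> R) e e' :
  cut_le p U e -> cut_le p U' e' -> cut_le p (fun x y => U x y + U' x y) (e + e').
Proof.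
move=> Ue Ue' f g f01 g01; rewrite bformD.
by apply: (le_trans (ler_normD _ _)); rewrite lerD ?Ue ?Ue'.
Qed.

Lemma cut_leN (T : finType) (p : T -> R) (U : T -> T -> R) e :
  cut_le p U e -> cut_le p (fun x y => - U x y) e.
Proof. by move=> Ue f g f01 g01; rewrite bformN normrN; apply: Ue. Qed.

Lemma cut_le_uniform (J : finType) (B : J -> J -> R) :
  cut_le (fun=> #|J|%:R^-1) B (cutn B / #|J|%:R ^+ 2).
Proof.
apply: cut_le_sets => S S'.
under eq_bigr do rewrite -mulr_sumr.
rewrite -mulr_sumr -invfM -expr2 normrM ger0_norm ?invr_ge0 ?sqr_ge0 // mulrC.
by rewrite ler_wpM2r ?invr_ge0 ?sqr_ge0 ?ler_cutn.
Qed.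

Section Map.
Variables (T T' : finType) (h : T' -> T) (q : T' -> R) (p : T -> R).
Hypothesis qp : forall t, \sum_(z | h z == t) q z = p t.

Lemma cut_le_push (U : T -> T -> R) e :
  cut_le q (fun z w => U (h z) (h w)) e -> cut_le p U e.
Proof.
move=> Ue f g f01 g01.
have -> : bform p U f g = bform q (fun z w => U (h z) (h w)) (f \o h) (g \o h).
  rewrite /bform [RHS](partition_big h xpredT) //=; apply: eq_bigr => x _.
  rewrite exchange_big /= [RHS](partition_big h xpredT) //=.
  apply: eq_bigr => y _; rewrite -!qp big_distrlr [RHS]exchange_big mulr_suml /=.
  rewrite mulr_suml; apply: eq_bigr => z /eqP hz.
  by rewrite !mulr_suml; apply: eq_bigr => w /eqP hw; rewrite hz hw.
by apply: Ue => z /=.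
Qed.

(** Test functions on [T'] are replaced by their averages over the fibres of [h], which again have
    values in [0,1]. *)
Lemma cut_le_pull (U : T -> T -> R) e :
  (forall z, 0 <= q z) -> (forall t, 0 < p t) ->
  cut_le p U e -> cut_le q (fun z w => U (h z) (h w)) e.
Proof.
move=> q0 p0 Ue f g f01 g01.
pose avg f t := (\sum_(z | h z == t) q z * f z) / p t.
have avg01 k : unit_fun k -> unit_fun (avg k).
  move=> k01 t; rewrite divr_ge0 ?(ltW (p0 t)) ?ler_pdivrMr //=.
    rewrite mul1r -qp; apply: ler_sum => z _.
    by rewrite -[leRHS]mulr1 ler_wpM2l //; case/andP: (k01 z).
  by apply: sumr_ge0 => z _; rewrite mulr_ge0 //; case/andP: (k01 z).
have -> : bform q (fun z w => U (h z) (h w)) f g = bform p U (avg f) (avg g).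
  rewrite /bform [LHS](partition_big h xpredT) //=; apply: eq_bigr => x _.
  rewrite exchange_big /= [LHS](partition_big h xpredT) //=.
  apply: eq_bigr => y _.
  have -> : p x * p y * U x y * (avg f x * avg g y) =
    U x y * ((\sum_(z | h z == x) q z * f z) * (\sum_(z | h z == y) q z * g z)).
    by rewrite /avg; field; rewrite !gt_eqF.
  rewrite big_distrlr mulr_sumr exchange_big; apply: eq_bigr => z /eqP hz.
  by rewrite mulr_sumr; apply: eq_bigr => w /eqP hw; rewrite hz hw /=; ring.
by apply: Ue; exact: avg01.
Qed.

End Map.

Lemma sum_coupling_fst (A B : finType) (p : A -> R) (p' : B -> R) X :
  coupling p p' X -> forall t, \sum_(z | z.1 == t) X z.1 z.2 = p t.
Proof.
move=> [_ X1 _] t; rewrite -X1 -[RHS](big_pred1_eq +%R t (fun a => \sum_b X a b)).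
by rewrite pair_big; apply: eq_bigl => z; rewrite andbT.
Qed.

Lemma sum_coupling_snd (A B : finType) (p : A -> R) (p' : B -> R) X :
  coupling p p' X -> forall t, \sum_(z | z.2 == t) X z.1 z.2 = p' t.
Proof.
move=> [_ _ X2] t; rewrite -X2.
under [RHS]eq_bigr => a _ do rewrite -(big_pred1_eq +%R t (X a)).
by rewrite pair_big.
Qed.

(** The couplings are made conditionally independent given [j]. On triples [(a, b, j)] the triangle
    inequality through [H] applies, and the bound is pushed forward to pairs. *)
Lemma glue_couplings (V1 V2 J : finType) (p1 : V1 -> R) (p2 : V2 -> R)
    (u : J -> R) Y Z (W1 : V1 -> V1 -> R) (W2 : V2 -> V2 -> R)
    (H : J -> J -> R) d1 d2 :
  (forall j, 0 < u j) -> coupling p1 u Y -> coupling p2 u Z ->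
  cut_le (fun z => Y z.1 z.2) (fun z w => W1 z.1 w.1 - H z.2 w.2) d1 ->
  cut_le (fun z => Z z.1 z.2) (fun z w => W2 z.1 w.1 - H z.2 w.2) d2 ->
  exists2 X, coupling p1 p2 X
    & cut_le (fun z => X z.1 z.2) (fun z w => W1 z.1 w.1 - W2 z.2 w.2) (d1 + d2).
Proof.
move=> u0 [Y0 Y1 Y2] [Z0 Z1 Z2] cY cZ.
pose X a b := \sum_j Y a j * Z b j / u j.
have X0 a b : 0 <= X a b.
  by apply: sumr_ge0 => j _; rewrite !mulr_ge0 // invr_ge0 ltW.
exists X.
  split=> // [a|b].
    rewrite exchange_big -Y1; apply: eq_bigr => j _ /=.
    by rewrite -mulr_suml -mulr_sumr Z2 mulfK // gt_eqF.
  rewrite exchange_big -Z1; apply: eq_bigr => j _ /=.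
  by rewrite -mulr_suml -mulr_suml Y2 mulrC mulKf // gt_eqF.
pose q (t : (V1 * V2) * J) := Y t.1.1 t.2 * Z t.1.2 t.2 / u t.2.
(* The kernel ignores the coordinate in [V'], which is averaged out of the test functions with the
   conditional weights [m b j]. *)
have half (V V' : finType) (Y' : V -> J -> R) (Z' : V' -> J -> R)
    (W : V -> V -> R) d (q' : V * V' * J -> R) :
    (forall a j, 0 <= Y' a j) -> (forall b j, 0 <= Z' b j) ->
    (forall j, \sum_b Z' b j = u j) ->
    (forall t, q' t = Y' t.1.1 t.2 * Z' t.1.2 t.2 / u t.2) ->
    cut_le (fun z => Y' z.1 z.2) (fun z w => W z.1 w.1 - H z.2 w.2) d ->
    cut_le q' (fun z w => W z.1.1 w.1.1 - H z.2 w.2) d.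
  move=> Y'0 Z'0 Z'2 q'E cY' f g f01 g01.
  pose m b j := Z' b j / u j.
  have m1 j : \sum_b m b j = 1 by rewrite -mulr_suml Z'2 divff // gt_eqF.
  have m0 b j : 0 <= m b j by rewrite mulr_ge0 // invr_ge0 ltW.
  pose avg (k : V * V' * J -> R) (z : V * J) := \sum_b m b z.2 * k (z.1, b, z.2).
  have avg01 k : unit_fun k -> unit_fun (avg k).
    move=> k01 z; apply/andP; split.
      by apply: sumr_ge0 => b _; rewrite mulr_ge0 //; case/andP: (k01 (z.1, b, z.2)).
    rewrite -(m1 z.2); apply: ler_sum => b _; rewrite -[leRHS]mulr1 ler_wpM2l //.
    by case/andP: (k01 (z.1, b, z.2)).
  have split3 (F : V * V' * J -> R) : \sum_t F t = \sum_(z : V * J) \sum_b F (z.1, b, z.2).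
    rewrite pair_bigA [LHS](reindex (fun t : V * J * V' => (t.1.1, t.2, t.1.2))) //.
    by exists (fun t => (t.1.1, t.2, t.1.2)) => [[[]]|[[]]].
  have -> : bform q' (fun z w => W z.1.1 w.1.1 - H z.2 w.2) f g =
      bform (fun z => Y' z.1 z.2) (fun z w => W z.1 w.1 - H z.2 w.2) (avg f) (avg g).
    rewrite /bform split3; apply: eq_bigr => z _.
    under eq_bigr do rewrite split3.
    rewrite exchange_big; apply: eq_bigr => w _.
    rewrite /avg big_distrlr /= mulr_sumr; apply: eq_bigr => b _.
    by rewrite mulr_sumr; apply: eq_bigr => b' _; rewrite !q'E /m /=; ring.
  by apply: cY'; exact: avg01.
have hX t : \sum_(z : V1 * V2 * J | z.1 == t) q z = X t.1 t.2.
  rewrite /X -[RHS](big_pred1_eq +%R t (fun a => \sum_j Y a.1 j * Z a.2 j / u j)).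
  by rewrite pair_big; apply: eq_bigl => z; rewrite andbT.
apply: (cut_le_push hX).
apply: (@eq_cut_le _ _ (fun z w =>
  (W1 z.1.1 w.1.1 - H z.2 w.2) + - (W2 z.1.2 w.1.2 - H z.2 w.2))).
  by move=> z w /=; ring.
apply: cut_leD; first exact: (half _ _ Y Z).
apply: cut_leN.
pose q' (t : V2 * V1 * J) := Z t.1.1 t.2 * Y t.1.2 t.2 / u t.2.
have hq' t : \sum_(z : V2 * V1 * J | (z.1.2, z.1.1, z.2) == t) q' z = q t.
  rewrite (big_pred1 (t.1.2, t.1.1, t.2)); first by rewrite /q' /q /= [Z _ _ * _]mulrC.
  case: t => [[a b] j] [[b' a'] j'] /=.
  by apply/eqP/eqP => -[-> -> ->].
apply: (cut_le_push hq').
exact: (half _ _ Z Y).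
Qed.

(** The common mass [mu] of each class is matched inside the class, in proportion to the weights
    ([M]); what remains is coupled as a product ([N]). Only [N] can mismatch, and its total mass is
    the sum of the [m c - mu c]. *)
Lemma class_coupling (A B C : finType) (p : A -> R) (p' : B -> R)
    (a : A -> C) (b : B -> C) : is_dist p -> is_dist p' ->
  exists2 X, coupling p p' X
    & \sum_x \sum_y X x y * (a x != b y)%:R <=
      \sum_c `|\sum_(x | a x == c) p x - \sum_(y | b y == c) p' y|.
Proof.
move=> [p0 p1] [p'0 p'1].
pose m c := \sum_(x | a x == c) p x; pose m' c := \sum_(y | b y == c) p' y.
pose mu c := Num.min (m c) (m' c).
have m0 c : 0 <= m c by apply: sumr_ge0.
have m'0 c : 0 <= m' c by apply: sumr_ge0.
have mu0 c : 0 <= mu c by rewrite le_min m0 m'0.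
have mum c : mu c <= m c by rewrite ge_min lexx.
have mum' c : mu c <= m' c by rewrite ge_min lexx orbT.
have mz c : m c = 0 -> mu c = 0.
  by move=> mc; apply/eqP; rewrite eq_le mu0 andbT -mc.
have m'z c : m' c = 0 -> mu c = 0.
  by move=> mc; apply/eqP; rewrite eq_le mu0 andbT -mc.
pose f x := p x * (mu (a x) / m (a x)); pose g y := p' y * (mu (b y) / m' (b y)).
have ratio1 (s t : R) : 0 <= s -> s <= t -> 0 <= t -> s / t <= 1.
  move=> s0 st; rewrite le_eqVlt => /predU1P[<-|t0]; first by rewrite invr0 mulr0.
  by rewrite ler_pdivrMr // mul1r.
have fp x : f x <= p x by rewrite -[leRHS]mulr1 ler_wpM2l // ratio1.
have gp y : g y <= p' y by rewrite -[leRHS]mulr1 ler_wpM2l // ratio1.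
pose M x y := p x * p' y * (mu (a x) / (m (a x) * m' (a x))) * (a x == b y)%:R.
have M0 x y : 0 <= M x y by rewrite !mulr_ge0 ?invr_ge0 ?mulr_ge0 ?ler0n.
have mE c k : \sum_x k * p x * (a x == c)%:R = k * m c.
  rewrite mulr_sumr [RHS]big_mkcond; apply: eq_bigr => x _.
  by case: ifP => _; rewrite ?mulr0 ?mulr1.
have m'E c k : \sum_y k * p' y * (c == b y)%:R = k * m' c.
  rewrite mulr_sumr [RHS]big_mkcond; apply: eq_bigr => y _.
  by rewrite eq_sym; case: ifP => _; rewrite ?mulr0 ?mulr1.
have Mrow x : \sum_y M x y = f x.
  rewrite /M /f.
  transitivity (p x * (mu (a x) / (m (a x) * m' (a x))) * m' (a x)).
    by rewrite -[RHS]m'E; apply: eq_bigr => y _; ring.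
  have [m'0'|m'N] := eqVneq (m' (a x)) 0; first by rewrite m'z // !(mul0r, mulr0).
  have [m0'|mN] := eqVneq (m (a x)) 0; first by rewrite mz // !(mul0r, mulr0).
  by field; rewrite m'N mN.
have Mcol y : \sum_x M x y = g y.
  rewrite /M /g.
  transitivity (p' y * (mu (b y) / (m (b y) * m' (b y))) * m (b y)).
    rewrite -[RHS]mE; apply: eq_bigr => x _.
    by case: eqP => [->|_]; [ring|rewrite !mulr0].
  have [m'0'|m'N] := eqVneq (m' (b y)) 0; first by rewrite m'z // !(mul0r, mulr0).
  have [m0'|mN] := eqVneq (m (b y)) 0; first by rewrite mz // !(mul0r, mulr0).
  by field; rewrite m'N mN.
pose t := \sum_x (p x - f x).
have sumf : \sum_x f x = \sum_y g y.
  by under eq_bigr do rewrite -Mrow; rewrite exchange_big; apply: eq_bigr.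
have tE : t = \sum_y (p' y - g y) by rewrite /t !sumrB p1 p'1 sumf.
have t0 : 0 <= t by apply: sumr_ge0 => x _; rewrite subr_ge0.
have tz x : t = 0 -> p x - f x = 0.
  by move=> /psumr_eq0P -> // x' _; rewrite subr_ge0.
have tz' y : t = 0 -> p' y - g y = 0.
  by rewrite tE => /psumr_eq0P -> // x' _; rewrite subr_ge0.
(* For [t = 0] no mass remains, and division by zero gives the right value 0. *)
pose N x y := (p x - f x) * (p' y - g y) / t.
have N0 x y : 0 <= N x y by rewrite !mulr_ge0 ?invr_ge0 ?subr_ge0.
have Nrow x : \sum_y N x y = p x - f x.
  rewrite -mulr_suml -mulr_sumr -tE; have [tt|tN] := eqVneq t 0.
    by rewrite tz // !mul0r.
  by rewrite mulfK.
have Ncol y : \sum_x N x y = p' y - g y.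
  rewrite -mulr_suml -mulr_suml -/t; have [tt|tN] := eqVneq t 0.
    by rewrite tz' // mulr0 mul0r.
  by rewrite mulrAC divff // mul1r.
exists (fun x y => M x y + N x y).
  split=> [x y|x|y]; first by rewrite addr_ge0.
    by rewrite big_split /= Mrow Nrow addrC subrK.
  by rewrite big_split /= Mcol Ncol addrC subrK.
apply: (@le_trans _ _ (\sum_x \sum_y N x y)).
  apply: ler_sum => x _; apply: ler_sum => y _; rewrite /M.
  by case: eqP => _ /=; rewrite ?mulr0 ?add0r ?mulr1.
under eq_bigr do rewrite Nrow.
rewrite (partition_big a xpredT) //=; apply: ler_sum => c _.
have -> : \sum_(x | a x == c) (p x - f x) = m c - mu c.
  rewrite sumrB; congr (_ - _).
  under eq_bigr => x /eqP ax do rewrite /f ax.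
  rewrite -mulr_suml -/(m c); have [mc|mN] := eqVneq (m c) 0.
    by rewrite mz // mc mul0r.
  by rewrite mulrC divfK.
rewrite -/(m c) -/(m' c) /mu; case: (leP (m c) (m' c)) => _; last exact: ler_norm.
by rewrite subrr.
Qed.

End CutTransport.

(** * The error of the sign sample *)

Section SignSample.
Variables (R : realFieldType) (V J : finType) (p : V -> R) (W : V -> V -> R).
Hypotheses (dp : is_dist p) (p0 : forall v, 0 < p v).
Hypotheses (W1 : forall u v, `|W u v| <= 1) (Wsym : forall u v, W u v = W v u).
Hypothesis J0 : (0 < #|J|)%N.

Let n : R := #|J|%:R.
Let n0 : 0 < n. Proof. by rewrite ltr0n. Qed.
Let dp' := fun _ : J => dp.
Let du : is_dist (fun _ : J => n^-1). Proof. exact: is_dist_uniform. Qed.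

Let sumc (a : R) : \sum_(j : J) a = n * a.
Proof. by rewrite sumr_const -[LHS]mulr_natl. Qed.

Definition class_dev (C : finType) (c : V -> C) (x : {ffun J -> V}) : R :=
  \sum_i `|\sum_(v | c v == i) p v - \sum_(j | c (x j) == i) n^-1|.

(** The sampled weight of a class of weight [m] has variance at most [m / n]. AM-GM uses the same
    [a] for all classes, whose weights sum to 1. *)
Lemma Ex_class_dev (C : finType) (c : V -> C) (a : R) : 0 < a ->
  Ex (fun _ : J => p) (class_dev c) <= ((n * a)^-1 + #|C|%:R * a) / 2.
Proof.
move=> a0; rewrite Ex_sum; have [_ p1] := dp.
have -> : ((n * a)^-1 + #|C|%:R * a) / 2 =
    \sum_i (n^-1 * (\sum_(v | c v == i) p v) / a + a) / 2.
  have cp1 : \sum_i \sum_(v | c v == i) p v = 1.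
    by rewrite -p1 [RHS](partition_big c xpredT).
  rewrite -mulr_suml big_split /= -mulr_suml -mulr_sumr cp1 mulr1.
  by rewrite sumr_const -[a *+ _]mulr_natl invfM.
apply: ler_sum => i _; set m := \sum_(v | _) p v.
have mE : \sum_v p v * (c v == i)%:R = m.
  by rewrite /m [RHS]big_mkcond; apply: eq_bigr => v _; case: ifP; rewrite ?mulr1 ?mulr0.
clearbody m.
pose b v : R := n^-1 * ((c v == i)%:R - m).
have bE (x : {ffun J -> V}) :
    m - \sum_(j | c (x j) == i) n^-1 = - \sum_j b (x j).
  rewrite -mulr_sumr sumrB sumc.
  have -> : \sum_(j | c (x j) == i) n^-1 = n^-1 * \sum_j (c (x j) == i)%:R.
    rewrite mulr_sumr [LHS]big_mkcond; apply: eq_bigr => j _.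
    by case: ifP; rewrite ?mulr1 ?mulr0.
  by field; rewrite gt_eqF.
have b0 : \sum_v p v * b v = 0.
  transitivity (n^-1 * (\sum_v p v * (c v == i)%:R - (\sum_v p v) * m)).
    rewrite mulr_suml -sumrB mulr_sumr; apply: eq_bigr => v _; rewrite /b; ring.
  by rewrite mE p1; ring.
have b2 : n * \sum_v p v * b v ^+ 2 <= n^-1 * m.
  have -> : n * \sum_v p v * b v ^+ 2 =
      n^-1 * (\sum_v p v * (c v == i)%:R - m ^+ 2).
    transitivity (n^-1 * (\sum_v p v * (c v == i)%:R
      - 2 * m * (\sum_v p v * (c v == i)%:R) + m ^+ 2 * \sum_v p v)).
      rewrite !mulr_sumr -sumrB -big_split mulr_sumr; apply: eq_bigr => v _ /=.
      rewrite /b; case: (c v == i) => /=; field; by rewrite gt_eqF.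
    by rewrite p1 mE; ring.
  by rewrite mE ler_pM2l ?invr_gt0 //; have := sqr_ge0 m; lra.
under eq_Ex do rewrite bE normrN.
apply: (le_trans (Ex_amgm _ dp' a0)).
rewrite ler_pM2r ?invr_gt0 ?ltr0n // lerD2r ler_pM2r ?invr_gt0 //.
by rewrite Ex_sum_var.
Qed.

Let cut_le_diag (B : J -> J -> R) : (forall i j, `|B i j| <= (i == j)%:R) ->
  cut_le (fun=> n^-1) B n^-1.
Proof.
move=> B1; apply: cut_le_sets => S S'.
apply: (@le_trans _ _ (\sum_i \sum_j n^-1 * n^-1 * (i == j)%:R)).
  apply: (le_trans (ler_norm_sum _ _ _)); rewrite [leLHS]big_mkcond.
  apply: ler_sum => i _; case: ifP => _; last first.
    by apply: sumr_ge0 => j _; rewrite !mulr_ge0 ?invr_ge0 ?(ltW n0).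
  apply: (le_trans (ler_norm_sum _ _ _)); rewrite [leLHS]big_mkcond.
  apply: ler_sum => j _; case: ifP => _; last first.
    by rewrite !mulr_ge0 ?invr_ge0 ?(ltW n0).
  by rewrite normrM ger0_norm ?ler_wpM2l ?mulr_ge0 ?invr_ge0 ?(ltW n0).
under eq_bigr do rewrite -mulr_sumr sum_1eq mulr1.
by rewrite sumc mulrA divff ?mul1r // gt_eqF.
Qed.

(** The entry differs by at most 2, and only if one of its two endpoints is mismatched; together
    this makes the factor 4. *)
Let cut_le_classes (C : finType) (c : V -> C) (k : C -> C -> R)
    (x : {ffun J -> V}) Y :
  (forall i j, `|k i j| <= 1) -> coupling p (fun=> n^-1) Y ->
  cut_le (fun z => Y z.1 z.2)
    (fun z w => k (c z.1) (c w.1) - k (c (x z.2)) (c (x w.2)))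
    (4 * \sum_v \sum_j Y v j * (c v != c (x j))%:R).
Proof.
move=> k1 [Y0 Y1 Y2] f g f01 g01.
pose bad (z : V * J) : R := (c z.1 != c (x z.2))%:R.
have sumY : \sum_z Y z.1 z.2 = 1.
  rewrite -(pair_bigA _ Y) /=; have [_ <-] := dp.
  by apply: eq_bigr => v _; rewrite Y1.
have -> : 4 * \sum_v \sum_j Y v j * (c v != c (x j))%:R =
    \sum_z \sum_w Y z.1 z.2 * Y w.1 w.2 * (2 * (bad z + bad w)).
  have -> : \sum_v \sum_j Y v j * (c v != c (x j))%:R = \sum_z Y z.1 z.2 * bad z.
    by rewrite pair_bigA.
  transitivity (2 * ((\sum_z Y z.1 z.2 * bad z) * (\sum_z Y z.1 z.2)
      + (\sum_z Y z.1 z.2) * (\sum_z Y z.1 z.2 * bad z))).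
    by rewrite sumY mulr1 mul1r; ring.
  rewrite !big_distrlr /= -big_split mulr_sumr; apply: eq_bigr => z _.
  by rewrite -big_split mulr_sumr; apply: eq_bigr => w _ /=; ring.
apply: (le_trans (ler_norm_sum _ _ _)); apply: ler_sum => z _.
apply: (le_trans (ler_norm_sum _ _ _)); apply: ler_sum => w _.
have /andP[f0 f1] := f01 z; have /andP[g0 g1] := g01 w.
rewrite -mulrA normrM ger0_norm ?mulr_ge0 // ler_wpM2l ?mulr_ge0 //.
rewrite normrM [X in _ * X]ger0_norm ?mulr_ge0 // -[leRHS]mulr1.
apply: ler_pM; rewrite ?mulr_ge0 ?mulr_ile1 //.
rewrite /bad -natrD; case: (eqVneq (c z.1)) => [->|_].
  case: (eqVneq (c w.1)) => [->|_]; first by rewrite subrr normr0 mulr0.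
  by rewrite mulr1; apply: (le_trans (ler_normB _ _)); rewrite -[2]/(1 + 1) lerD.
apply: (le_trans (ler_normB _ _)).
apply: (@le_trans _ _ (1 + 1)); first exact: lerD.
by rewrite -[1 + 1]/2 ler_peMr ?ler0n // ler1n.
Qed.

(** In order: the error of the step approximation, mismatched classes, the sampled remainder
    [W - k], the noise, and the diagonal, where the signed graph is 0. *)
Definition sign_error (C : finType) (c : V -> C) (k : C -> C -> R) (e : R)
    (x : {ffun J -> V}) (s : {ffun J * J -> bool}) : R :=
  e + 4 * class_dev c x
  + cutn (fun i j => W (x i) (x j) - k (c (x i)) (c (x j))) / n ^+ 2
  + cutn (noise (fun i j => W (x i) (x j)) s) / n ^+ 2 + n^-1.

Lemma sign_error_coupling (C : finType) (c : V -> C) (k : C -> C -> R) e x s :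
  (forall i j, `|k i j| <= 1) ->
  cut_le p (fun u v => W u v - k (c u) (c v)) e ->
  exists2 Y, coupling p (fun=> n^-1) Y
    & cut_le (fun z => Y z.1 z.2)
        (fun z w => W z.1 w.1 - sign_mx R s z.2 w.2) (sign_error c k e x s).
Proof.
move=> k1 ce; have [Y cY Ymis] := class_coupling c (fun j => c (x j)) dp du.
exists Y => //; have [Y0 Y1 Y2] := cY.
pose B i j := W (x i) (x j).
have Yge0 (z : V * J) : 0 <= Y z.1 z.2 by [].
have ninv0 (j : J) : 0 < n^-1 by rewrite invr_gt0.
have onV := cut_le_pull (sum_coupling_fst cY) Yge0 p0 ce.
have onJ (H : J -> J -> R) d : cut_le (fun=> n^-1) H d ->
    cut_le (fun z => Y z.1 z.2) (fun z w => H z.2 w.2) d.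
  by move=> Hd; apply: (cut_le_pull (sum_coupling_snd cY) Yge0 ninv0 Hd).
have onU := cut_leN (onJ _ _ (cut_le_uniform (fun i j => B i j - k (c (x i)) (c (x j))))).
have onN := cut_leN (onJ _ _ (cut_le_uniform (noise B s))).
have onD : cut_le (fun z => Y z.1 z.2)
    (fun z w => if z.2 == w.2 then B z.2 w.2 else 0) n^-1.
  apply: (onJ (fun i j => if i == j then B i j else 0)).
  apply: cut_le_diag => i j; case: ifP => _; last by rewrite normr0.
  exact: W1.
have onK : cut_le (fun z => Y z.1 z.2)
    (fun z w => k (c z.1) (c w.1) - k (c (x z.2)) (c (x w.2))) (4 * class_dev c x).
  move=> f g f01 g01; apply: (le_trans (@cut_le_classes C c k x Y k1 cY f g f01 g01)).
  by rewrite ler_pM2l ?ltr0n.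
(* Writing [[x]] for sampled kernels, [W - s = (W - k) + (k - k[x]) - (W[x] - k[x]) - noise +
   diagonal of W[x]]. *)
have := cut_leD (cut_leD (cut_leD (cut_leD onV onK) onU) onN) onD.
apply: eq_cut_le => z w; rewrite /noise /sign_mx /B.
by case: (z.2 == w.2); ring.
Qed.

Lemma sign_error_ge0 (C : finType) (c : V -> C) (k : C -> C -> R) e x s :
  0 <= e -> 0 <= sign_error c k e x s.
Proof.
move=> e0; rewrite !addr_ge0 ?mulr_ge0 ?invr_ge0 ?cutn_ge0 ?sqr_ge0 ?(ltW n0) //.
exact: sumr_ge0.
Qed.

(** The AM-GM parameters stay free: [a] for the class deviation, [a1] for the subsampling, [a2] and
    [a3] for the noise. *)
Lemma Ex_sign_error (C : finType) (c : V -> C) (k : C -> C -> R)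
    (e d a a1 a2 a3 : R) (q : nat) :
  (forall i j, `|k i j| <= 1) ->
  cut_le p (fun u v => W u v - k (c u) (c v)) e ->
  0 < d -> 1 <= q%:R * d ^+ 2 -> 0 < a -> 0 < a1 -> 0 < a2 -> 0 < a3 ->
  Ex (fun _ : J => p) (fun x =>
    Ex (sign_law (fun i j => W (x i) (x j))) (sign_error c k e x)) <=
  e + 4 * (((n * a)^-1 + #|C|%:R * a) / 2)
  + (n ^+ 2 * e + 8 * q%:R * 2 * n
     + ((2 * 4 ^+ q) * (20 * 2 ^+ 2 * n ^+ 3) / a1 + a1) / 2
     + 2 * n ^+ 2 * (2 * d)) / n ^+ 2
  + ((4 * n ^+ 2 + n ^+ 2 * ((16 * n / a3 + a3) / 2)) / a2 + n * a2) / 2 / n ^+ 2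
  + n^-1.
Proof.
move=> k1 ce d0 qd a0 a10 a20 a30.
have ds (x : {ffun J -> V}) := is_dist_sign_law (fun i j => W1 (x i) (x j)).
pose U u v := W u v - k (c u) (c v).
have U2 u v : `|U u v| <= 2.
  apply: (le_trans (ler_normB _ _)); have := W1 u v; have := k1 (c u) (c v); lra.
set N := (_ / a2 + n * a2) / 2.
have inner (x : {ffun J -> V}) : Ex (sign_law (fun i j => W (x i) (x j))) (sign_error c k e x) <=
    (e + n^-1 + N / n ^+ 2) + 4 * class_dev c x
    + (n ^+ 2)^-1 * cutn (fun i j => U (x i) (x j)).
  have E s : sign_error c k e x s =
      (e + n^-1 + 4 * class_dev c x + (n ^+ 2)^-1 * cutn (fun i j => U (x i) (x j)))
      + (n ^+ 2)^-1 * cutn (noise (fun i j => W (x i) (x j)) s).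
    by rewrite /sign_error -/(U _ _) /U; ring.
  rewrite (eq_Ex _ E) ExD Ex_cst // ExZ.
  have := Ex_cutn_noise (fun i j => W1 (x i) (x j)) (fun i j => Wsym (x i) (x j)) a20 a30.
  rewrite -/n -/N => le_N.
  have : (n ^+ 2)^-1 * Ex (sign_law (fun i j => W (x i) (x j)))
      (fun s => cutn (noise (fun i j => W (x i) (x j)) s)) <= (n ^+ 2)^-1 * N.
    by rewrite ler_pM2l // invr_gt0 exprn_gt0.
  by rewrite [N / _]mulrC; lra.
apply: (le_trans (le_Ex dp' inner)); rewrite ExD ExD Ex_cst // !ExZ.
have := Ex_class_dev c a0; have := cut_sampling dp (ltr0n R 2) U2 ce J0 d0 qd a10.
rewrite -/n; set S := _ + 2 * n ^+ 2 * (2 * d) => le_S le_C.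
have : (n ^+ 2)^-1 * Ex (fun=> p) (fun x : {ffun J -> V} => cutn (fun i j => U (x i) (x j)))
    <= (n ^+ 2)^-1 * S.
  by rewrite ler_pM2l // invr_gt0 exprn_gt0.
by rewrite [S / _]mulrC; lra.
Qed.

End SignSample.

(** * Overlays of weighted graphs *)

Lemma Ex_pushforward (R : realFieldType) (I T T' : finType) (p : T -> R)
    (q : T' -> R) (h : T' -> T) (F : {ffun I -> T} -> R) :
  (forall t, \sum_(z | h z == t) q z = p t) ->
  Ex (fun=> q) (fun z => F [ffun i => h (z i)]) = Ex (fun=> p) F.
Proof.
move=> qp; rewrite /Ex (partition_big (fun z : {ffun I -> T'} => [ffun i => h (z i)]) predT) //=.
apply: eq_bigr => x _.
rewrite -(eq_bigr _ (fun i _ => qp (x i))) bigA_distr_big_dep mulr_suml.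
apply: eq_big => [z|z /eqP -> //].
apply/eqP/familyP => [<- i|zx]; first by rewrite ffunE unfold_in.
by apply/ffunP => i; rewrite ffunE; apply/eqP/zx.
Qed.

Section WeightedGraphs.
Variable R : realType.

Lemma is_dist_wnormalize (V : finType) (G : wgraph R V) :
  weighted_graph G -> is_dist (nodew (wnormalize G)).
Proof.
move=> wG; split=> [i|]; last exact: (total_wnormalize wG).
by have [_ w0 _] := wG; rewrite divr_ge0 ?ltW // total_nodew_gt0.
Qed.

Lemma hom_densityE (V : finType) (F : sgraph) (G : wgraph R V) :
  hom_density F G =
  Ex (fun=> nodew (wnormalize G)) (fun phi : {ffun vertex F -> V} =>
    \prod_(e in edges F) edgew G (phi e.1) (phi e.2)).
Proof.
rewrite /hom_density mulr_sumr; apply: eq_bigr => phi _ /=.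
by rewrite big_split /= prodr_const exprVn mulrCA !mulrA.
Qed.

Lemma edgew_norm_le1 (V : finType) (G : wgraph R V) :
  edgew_unit G -> forall i j, `|edgew G i j| <= 1.
Proof. by move=> uG i j; rewrite ler_norml; apply: uG. Qed.

Section Overlay.
Variables (V1 V2 : finType) (G1 : wgraph R V1) (G2 : wgraph R V2).
Hypotheses (wG1 : weighted_graph G1) (wG2 : weighted_graph G2).

Let edgeD (z w : V1 * V2) := edgew G1 z.1 w.1 - edgew G2 z.2 w.2.

Lemma overlay_cut_dist X :
  frac_overlay (wnormalize G1) (wnormalize G2) X ->
  cut_dist (overlay_l (wnormalize G1) X) (overlay_r (wnormalize G2) X) =
  \big[Num.max/0]_(ST : {set V1 * V2} * {set V1 * V2})
    `|\sum_(z in ST.1) \sum_(w in ST.2)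
        X z.1 z.2 * X w.1 w.2 * edgeD z w|.
Proof.
move=> [_ X1 _]; rewrite /cut_dist.
have -> : total_nodew (overlay_l (wnormalize G1) X) = 1.
  rewrite -(total_wnormalize wG1) /total_nodew.
  by under [RHS]eq_bigr do rewrite -X1; rewrite pair_big.
apply: eq_bigr => ST _; rewrite expr1n invr1 mul1r /eweight -sumrB.
congr `|_|; apply: eq_bigr => z _; rewrite -sumrB; apply: eq_bigr => w _.
by rewrite /= -mulrBr.
Qed.

Lemma delta_cut_le X D : 0 <= D ->
  frac_overlay (wnormalize G1) (wnormalize G2) X ->
  cut_le (fun z => X z.1 z.2) edgeD D -> delta_cut G1 G2 <= D.
Proof.
move=> D0 oX XD; have [_ lb] := delta_cut_min wG1 wG2.
apply: (le_trans (lb _ (ex_intro2 _ _ X oX erefl))).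
rewrite overlay_cut_dist //; apply: bigmax_le => // -[S S'] _ /=.
rewrite -(bform_mem (fun z => X z.1 z.2) edgeD).
by apply: XD => x; rewrite ler0n lern1 leq_b1.
Qed.

Lemma delta_cut_attained : exists2 X,
  frac_overlay (wnormalize G1) (wnormalize G2) X &
  cut_le (fun z => X z.1 z.2) edgeD (delta_cut G1 G2).
Proof.
have [[X oX ->] _] := delta_cut_min wG1 wG2; exists X => //.
apply: cut_le_sets => S S'; rewrite overlay_cut_dist //.
exact: (le_bigmax _ _ (S, S')).
Qed.

Lemma is_dist_overlay X : frac_overlay (wnormalize G1) (wnormalize G2) X ->
  is_dist (fun z => X z.1 z.2).
Proof.
move=> [X0 X1 _]; split=> [z|]; first exact: X0.
rewrite -(pair_bigA _ X) /=; have [_ <-] := is_dist_wnormalize wG1.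
by apply: eq_bigr => i _; rewrite X1.
Qed.

Lemma delta_cut_le2 : edgew_unit G1 -> edgew_unit G2 -> delta_cut G1 G2 <= 2.
Proof.
move=> uG1 uG2; have oX := frac_overlay_prod wG1 wG2.
apply: (delta_cut_le _ oX) => //; apply: cut_le_bound => [|z w].
  exact: is_dist_overlay oX.
apply: (le_trans (ler_normB _ _)).
by have := edgew_norm_le1 uG1 z.1 w.1; have := edgew_norm_le1 uG2 z.2 w.2; lra.
Qed.

Lemma counting_delta_cut (F : sgraph) : edgew_unit G1 -> edgew_unit G2 ->
  `|hom_density F G1 - hom_density F G2|
    <= 4 * #|edges F|%:R * delta_cut G1 G2.
Proof.
move=> uG1 uG2; have [X oX cX] := delta_cut_attained.
have dX := is_dist_overlay oX.
have edges_irr d : d \in edges F -> d.1 != d.2.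
  by rewrite inE => /andP[_]; apply: contraTneq => ->; rewrite ltnn.
have edges_asym d : d \in edges F -> (d.2, d.1) \notin edges F.
  by rewrite !inE /= => /andP[_ /ltnW]; rewrite leqNgt => /negbTE ->; rewrite andbF.
have := counting dX edges_irr edges_asym
  (fun z w => edgew_norm_le1 uG1 z.1 w.1) (fun z w => edgew_norm_le1 uG2 z.2 w.2) cX.
rewrite !hom_densityE.
(* The marginals of the overlay are the node weights, so both densities become expectations over the
   same random nodes. *)
rewrite -(Ex_pushforward (h := fst) _ (sum_coupling_fst oX)).
rewrite -(Ex_pushforward (h := snd) _ (sum_coupling_snd oX)).
set a := Ex _ _; set b := Ex _ _; set c := Ex _ _; set d := Ex _ _.
have -> : a = c by apply: eq_Ex => z; apply: eq_bigr => e _; rewrite !ffunE.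
by have -> : b = d by apply: eq_Ex => z; apply: eq_bigr => e _; rewrite !ffunE.
Qed.

End Overlay.
End WeightedGraphs.

(** * Laws of sign patterns *)

(* Read [w1 x s] and [w2 y s] as the joint laws of two experiments whose
   observations [s] have nearly the same law: some [s] is then good for both. *)
Lemma common_observation (R : realFieldType) (X1 X2 S : finType)
    (w1 : X1 -> S -> R) (w2 : X2 -> S -> R) (D1 : X1 -> S -> R)
    (D2 : X2 -> S -> R) (d e1 e2 t : R) :
  (forall x s, 0 <= w1 x s) -> (forall y s, 0 <= w2 y s) ->
  (forall x s, 0 <= D1 x s) -> (forall y s, 0 <= D2 y s) ->
  \sum_s \sum_x w1 x s = 1 -> X2 -> 0 <= d ->
  (forall s, `|\sum_x w1 x s - \sum_y w2 y s| <= t) ->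
  (forall x y s, d <= D1 x s + D2 y s) ->
  \sum_s \sum_x w1 x s * D1 x s <= e1 -> \sum_s \sum_y w2 y s * D2 y s <= e2 ->
  d * (1 - #|S|%:R * t) <= e1 + e2.
Proof.
move=> w10 w20 D10 D20 w1s y0 d0 wt dD le1 le2.
have [x0 _] : exists x0 : X1, true.
  case: (pickP (fun _ : X1 => true)) => [x _|X0]; first by exists x.
  have := w1s; rewrite big1 => [/esym/eqP|s _]; first by rewrite oner_eq0.
  by rewrite big1 // => x; have := X0 x.
apply: le_trans (lerD le1 le2).
have -> : #|S|%:R * t = \sum_(s : S) t by rewrite sumr_const mulr_natl.
rewrite -w1s -sumrB mulr_sumr -big_split; apply: ler_sum => s _ /=.
(* For each [s] the smallest errors [u] and [v] satisfy [d <= u + v], so [u * a + v * b] is at least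
   [d] times the minimum of [a] and [b], hence at least [d * (a - t)]. *)
pose x1 := [arg min_(x < x0) D1 x s]%O; pose y1 := [arg min_(y < y0) D2 y s]%O.
have x1m x : D1 x1 s <= D1 x s.
  by rewrite /x1; case: arg_minP => // i _; apply.
have y1m y : D2 y1 s <= D2 y s.
  by rewrite /y1; case: arg_minP => // i _; apply.
set a := \sum_x w1 x s; set b := \sum_y w2 y s.
have a0 : 0 <= a by apply: sumr_ge0.
have b0 : 0 <= b by apply: sumr_ge0.
have A : D1 x1 s * a <= \sum_x w1 x s * D1 x s.
  by rewrite mulrC mulr_suml; apply: ler_sum => x _; rewrite ler_wpM2l.
have B : D2 y1 s * b <= \sum_y w2 y s * D2 y s.
  by rewrite mulrC mulr_suml; apply: ler_sum => y _; rewrite ler_wpM2l.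
apply: le_trans (lerD A B).
have := wt s; rewrite -/a -/b ler_norml => /andP[ab1 ab2].
have := dD x1 y1 s; have := D10 x1 s; have := D20 y1 s.
move: (D1 x1 s) (D2 y1 s) => u v v0 u0 duv.
pose m := Num.min a b.
have m0 : 0 <= m by rewrite le_min a0.
have ma : m <= a by rewrite ge_min lexx.
have mb : m <= b by rewrite ge_min lexx orbT.
have am : a - t <= m by rewrite le_min; apply/andP; split; lra.
have := ler_wpM2l d0 am; have := ler_wpM2r m0 duv.
have := ler_wpM2l u0 ma; have := ler_wpM2l v0 mb; lra.
Qed.

Section SignPatterns.
Variables (R : realType) (J : finType).

Definition pair_adj (E : {set J * J}) (i j : J) : bool :=
  ((i, j) \in E) && before i j || ((j, i) \in E) && before j i.

Lemma pair_adj_sym E : symmetric (pair_adj E).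
Proof. by move=> i j; rewrite /pair_adj orbC. Qed.

Lemma pair_adj_irr E : irreflexive (pair_adj E).
Proof. by move=> i; rewrite /pair_adj /before ltnn !andbF. Qed.

Definition pair_graph (E : {set J * J}) : sgraph :=
  SGraph (@pair_adj_sym E) (@pair_adj_irr E).

Lemma edges_pair_graph (E : {set J * J}) :
  (forall d, d \in E -> before d.1 d.2) -> edges (pair_graph E) = E.
Proof.
move=> Eb; apply/setP => -[i j]; rewrite inE /= /pair_adj -/(before i j).
case: (boolP ((i, j) \in E)) => [ijE|_] /=; first by have /= -> := Eb _ ijE.
by rewrite /before; case: ltngtP => //=; rewrite !andbF.
Qed.

Definition sign_prob (V : finType) (G : wgraph R V)
    (x : {ffun J -> V}) (s : {ffun J * J -> bool}) : R :=
  \prod_d sign_law (fun i j => edgew G (x i) (x j)) d (s d).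

(** The product of the factors [(1 + sign * weight) / 2] expands into one term per set [E] of pairs,
    with mean the density of the graph with edge set [E]. Pairs out of order contribute only
    [1 / 2]. *)
Lemma Ex_sign_prob (V : finType) (G : wgraph R V) (s : {ffun J * J -> bool}) :
  Ex (fun=> nodew (wnormalize G)) (fun x => sign_prob G x s) =
  2 ^- #|{: J * J}| * \sum_(E : {set J * J} | [forall d in E, before d.1 d.2])
    (\prod_(d in E) (-1) ^+ s d) * hom_density (pair_graph E) G.
Proof.
have expand x : sign_prob G x s = 2 ^- #|{: J * J}| *
    \sum_(E : {set J * J} | [forall d in E, before d.1 d.2])
    (\prod_(d in E) (-1) ^+ s d) * \prod_(d in E) edgew G (x d.1) (x d.2).
  pose a (d : J * J) : R := if before d.1 d.2
    then (-1) ^+ s d * edgew G (x d.1) (x d.2) else 0.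
  transitivity (\prod_(d : J * J) (2^-1 * (a d + 1))).
    apply: eq_bigr => d _; rewrite /sign_law /a.
    by case: ifP => _; [rewrite mulrC addrC|rewrite add0r mulr1].
  rewrite big_split /= prodr_const exprVn; congr (_ * _).
  rewrite bigA_distr [RHS]big_mkcond; apply: eq_bigr => E _.
  rewrite -big_mkcond /=; case: ifP => [/forall_inP Eb|/negbT].
    rewrite -big_split; apply: eq_bigr => d dE.
    by rewrite /a Eb.
  rewrite negb_forall => /existsP[d]; rewrite negb_imply => /andP[dE /negbTE nb].
  by rewrite (bigD1 d) //= /a nb mul0r.
rewrite (eq_Ex _ expand) ExZ Ex_sum; congr (_ * _); apply: eq_bigr => E /forall_inP Eb.
by rewrite ExZ hom_densityE edges_pair_graph.
Qed.

(** With [N] pairs there are at most [2 ^ N] densities, each with a coefficient of absolute value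
    [2 ^- N]. *)
Lemma sign_prob_dist (V1 V2 : finType) (G1 : wgraph R V1) (G2 : wgraph R V2) t s :
  0 <= t ->
  (forall F : sgraph, #|vertex F| = #|J| ->
     `|hom_density F G1 - hom_density F G2| <= t) ->
  `|Ex (fun=> nodew (wnormalize G1)) (fun x => sign_prob G1 x s)
    - Ex (fun=> nodew (wnormalize G2)) (fun x => sign_prob G2 x s)| <= t.
Proof.
move=> t0 Ft; rewrite !Ex_sign_prob -mulrBr -sumrB normrM.
rewrite ger0_norm ?invr_ge0 ?exprn_ge0 // mulrC ler_pdivrMr ?exprn_gt0 //.
apply: (le_trans (ler_norm_sum _ _ _)).
apply: (@le_trans _ _ (\sum_(E : {set J * J}) t)).
  rewrite [leLHS]big_mkcond; apply: ler_sum => E _; case: ifP => // _.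
  rewrite -mulrBr normrM normr_prod big1 ?mul1r; first exact: Ft.
  by move=> d _; rewrite normrX normrN1 expr1n.
rewrite sumr_const -[leLHS]mulr_natr -(cardsT {set J * J}) -powersetT card_powerset.
by rewrite cardsT natrX.
Qed.

End SignPatterns.

(** * The sampling bound *)

(** Here [t] stands for [2 ^- h]. The AM-GM parameters are chosen so that every term without [e] or
    [d] is at most a multiple of [t]; the multiples add up to 156.25. *)
Lemma sampling_error_bound (R : realFieldType) (n t e d m : R) (h : nat) :
  0 < n -> 0 < t -> t <= 1 -> n^-1 <= t ^+ 10 -> h%:R * t <= 1 ->
  4 ^+ (4 * h) = t ^- 8 -> 0 <= m -> m <= 4 ^+ (4 * h) ->
  e + 4 * (((n * t ^+ 9)^-1 + m * t ^+ 9) / 2)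
  + (n ^+ 2 * e + 8 * (4 * h)%:R * 2 * n
     + ((2 * 4 ^+ (4 * h)) * (20 * 2 ^+ 2 * n ^+ 3) / (n ^+ 2 * t) + n ^+ 2 * t) / 2
     + 2 * n ^+ 2 * (2 * d)) / n ^+ 2
  + ((4 * n ^+ 2 + n ^+ 2 * ((16 * n / (n * t ^+ 4) + n * t ^+ 4) / 2))
       / (n * t ^+ 2) + n * (n * t ^+ 2)) / 2 / n ^+ 2
  + n^-1 <= 2 * e + 4 * d + 157 * t.
Proof.
move=> n0 t0 t1 nt ht -> m0 mt.
have tN : t != 0 by rewrite gt_eqF.
have nN : n != 0 by rewrite gt_eqF.
have pw i : t ^+ i.+1 <= t by rewrite exprS ler_piMr ?(ltW t0) // exprn_ile1 ?(ltW t0).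
have vt i j : (i + j = 10)%N -> n^-1 * t ^- i <= t ^+ j.
  move=> ij; rewrite ler_pdivrMr ?exprn_gt0 // -exprD addnC ij //.
have v9 := vt 9%N 1%N erefl; have v2 := vt 2%N 8%N erefl; have v6 := vt 6%N 4%N erefl.
rewrite expr1 in v9.
have mt9 : m * t ^+ 9 <= t.
  have tE : t ^- 8 * t ^+ 9 = t by field.
  by rewrite -[leRHS]tE ler_pM2r ?exprn_gt0.
have hv : h%:R * n^-1 <= t.
  apply: (@le_trans _ _ (h%:R * t ^+ 10)); first by rewrite ler_wpM2l.
  by rewrite exprS mulrA; apply: le_trans (pw 8%N); rewrite ler_piMl ?exprn_ge0 ?(ltW t0).
have v1 : n^-1 <= t := le_trans nt (pw 9%N).
have -> : 4 * (((n * t ^+ 9)^-1 + m * t ^+ 9) / 2) =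
    2 * (n^-1 * t ^- 9) + 2 * (m * t ^+ 9) by field; rewrite tN nN.
rewrite natrM.
have -> : (n ^+ 2 * e + 8 * (4 * h%:R) * 2 * n
     + ((2 * t ^- 8) * (20 * 2 ^+ 2 * n ^+ 3) / (n ^+ 2 * t) + n ^+ 2 * t) / 2
     + 2 * n ^+ 2 * (2 * d)) / n ^+ 2
   = e + 64 * (h%:R * n^-1) + (80 * (n^-1 * t ^- 9) + t / 2) + 4 * d.
  by field; rewrite tN nN.
have -> : ((4 * n ^+ 2 + n ^+ 2 * ((16 * n / (n * t ^+ 4) + n * t ^+ 4) / 2))
       / (n * t ^+ 2) + n * (n * t ^+ 2)) / 2 / n ^+ 2
   = 2 * (n^-1 * t ^- 2) + 4 * (n^-1 * t ^- 6) + 3 / 4 * t ^+ 2.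
  by field; rewrite tN nN.
have := pw 1%N; have := pw 3%N; have := pw 7%N.
by lra.
Qed.

(** The factor 341 is the largest possible at [h = 12]: [341 * 12 = 4092] and [2 ^ 12 = 4096]. *)
Lemma leq_exp2_linear (h : nat) : (12 <= h)%N -> (341 * h <= 2 ^ h)%N.
Proof.
move=> /subnKC <-; elim: (h - 12)%N => [//|m IHm].
rewrite addnS expnS mul2n -addnn mulnS addnC leq_add //.
apply: leq_trans IHm; rewrite leq_pmulr //.
Qed.

Section DeltaCut.
Variables (R : realType) (V1 V2 : finType).
Variables (G1 : wgraph R V1) (G2 : wgraph R V2).
Hypotheses (wG1 : weighted_graph G1) (wG2 : weighted_graph G2).
Hypotheses (uG1 : edgew_unit G1) (uG2 : edgew_unit G2).

Let wnormalize_gt0 (V : finType) (G : wgraph R V) : weighted_graph G ->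
  forall v, 0 < nodew (wnormalize G) v.
Proof.
by move=> wG v; have [_ w0 _] := wG; rewrite divr_gt0 // total_nodew_gt0.
Qed.

(* [D x s] bounds the cut distance of [G] and the signed complete graph [s] when
   [s] is drawn from the sample [x]. *)
Lemma sign_experiment (V : finType) (G : wgraph R V) (k h : nat) :
  weighted_graph G -> edgew_unit G -> (12 <= h)%N -> (2 ^ (10 * h) <= k)%N ->
  exists D : {ffun 'I_k -> V} -> {ffun 'I_k * 'I_k -> bool} -> R,
  [/\ forall x s, 0 <= D x s,
      forall x s, exists2 Y,
        coupling (nodew (wnormalize G)) (fun=> #|'I_k|%:R^-1) Y &
        cut_le (fun z => Y z.1 z.2)
          (fun z w => edgew G z.1 w.1 - sign_mx R s z.2 w.2) (D x s)
    & \sum_s \sum_(x : {ffun 'I_k -> V})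
        (\prod_i nodew (wnormalize G) (x i)) * sign_prob G x s * D x s
      <= 315 / 100 / Num.sqrt h%:R].
Proof.
move=> wG uG h12 hk.
have dp := is_dist_wnormalize wG; have p0 := wnormalize_gt0 wG.
have W1 := edgew_norm_le1 uG; have [_ _ Wsym] := wG.
have h0 : (0 < h)%N by apply: leq_trans h12.
pose r : R := Num.sqrt h%:R.
have r2 : r ^+ 2 = h%:R by rewrite sqr_sqrtr.
have r0 : 0 < r by rewrite sqrtr_gt0 ltr0n.
have r31 : 31 / 10 <= r.
  have : 12 <= r ^+ 2 by rewrite r2 ler_nat.
  by move=> r12; rewrite leNgt; apply/negP => r31; nra.
(* Used both as regularity error and as subsampling accuracy: [4 * h * e ^+ 2 = 1], and the leading
   error [2 * e + 4 * e] is [3 / r]. *)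
pose e : R := (2 * r)^-1.
have e0 : 0 < e by rewrite invr_gt0 mulr_gt0.
have he : 1 <= (4 * h)%:R * e ^+ 2.
  by apply: eq_ler; rewrite natrM -r2 /e; field; rewrite gt_eqF.
have [C [c [kk [Cle kk1 ce]]]] := weak_regularity dp W1 (ltW e0) he.
have k0 : (0 < k)%N by apply: leq_trans hk; rewrite expn_gt0.
have J0 : (0 < #|'I_k|)%N by rewrite card_ord.
pose n : R := #|'I_k|%:R; have n0 : 0 < n by rewrite ltr0n.
pose t : R := 2 ^- h.
have t0 : 0 < t by rewrite invr_gt0 exprn_gt0.
have t1 : t <= 1 by rewrite invf_le1 ?exprn_gt0 // exprn_ege1 // ler1n.
have nt : n^-1 <= t ^+ 10.
  rewrite /t exprVn lef_pV2 ?posrE ?exprn_gt0 //.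
  by rewrite -exprM mulnC /n card_ord -natrX ler_nat.
have th : 341 * (h%:R * t) <= 1.
  rewrite mulrA ler_pdivrMr ?exprn_gt0 // mul1r -natrM -natrX ler_nat.
  exact: leq_exp2_linear.
have ht : h%:R * t <= 1 by have := mulr_ge0 (ler0n R h) (ltW t0); lra.
have t8 : 4 ^+ (4 * h) = t ^- 8 :> R.
  rewrite /t exprVn invrK -exprM (_ : 4 = 2 ^+ 2 :> R); last by ring.
  by rewrite -exprM mulnA mulnC.
exists (sign_error (nodew (wnormalize G)) (edgew G) c kk e); split=> [x s|x s|].
- by apply: sign_error_ge0 => //; apply: ltW.
- exact: sign_error_coupling.
have := @Ex_sign_error _ _ 'I_k _ _ dp W1 Wsym J0 C c kk e e
  (t ^+ 9) (n ^+ 2 * t) (n * t ^+ 2) (n * t ^+ 4) (4 * h) kk1 ce e0 he.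
rewrite !exprn_gt0 ?mulr_gt0 ?exprn_gt0 // => /(_ isT isT isT isT).
have mC : #|C|%:R <= 4 ^+ (4 * h) :> R by rewrite -natrX ler_nat.
have := sampling_error_bound e e n0 t0 t1 nt ht t8 (ler0n R #|C|) mC.
move=> /[swap] /le_trans /[apply] err.
have -> : \sum_s \sum_(x : {ffun 'I_k -> V})
    (\prod_i nodew (wnormalize G) (x i)) * sign_prob G x s *
    sign_error (nodew (wnormalize G)) (edgew G) c kk e x s =
  Ex (fun=> nodew (wnormalize G)) (fun x : {ffun 'I_k -> V} =>
    Ex (sign_law (fun i j => edgew G (x i) (x j)))
      (sign_error (nodew (wnormalize G)) (edgew G) c kk e x)).
  rewrite exchange_big; apply: eq_bigr => x _; rewrite mulr_sumr.
  by apply: eq_bigr => s _; rewrite mulrA.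
apply: (le_trans err); rewrite -/r.
rewrite ler_pdivlMr //.
have -> : (2 * e + 4 * e + 157 * t) * r = 3 + 157 * (t * r).
  by rewrite /e; field; rewrite gt_eqF.
(* As [r >= 31 / 10], the rest [157 * (t * r)] is at most [157 / (341 * 3.1) < 0.15], which explains
   315 / 100. *)
have {th} : 341 * (r * (r * t)) <= 1 by rewrite [r * _]mulrA -expr2 r2.
by have := mulr_gt0 t0 r0; nra.
Qed.

Lemma delta_cut_sampling (k h : nat) : (12 <= h)%N -> (2 ^ (10 * h) <= k)%N ->
  (forall F : sgraph, #|vertex F| = k ->
     `|hom_density F G1 - hom_density F G2| <= 3 ^- (k ^ 2)) ->
  delta_cut G1 G2 <= 66 / 10 / Num.sqrt h%:R.
Proof.
move=> h12 hk close.
have [D1 [D10 D1c D1e]] := sign_experiment wG1 uG1 h12 hk.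
have [D2 [D20 D2c D2e]] := sign_experiment wG2 uG2 h12 hk.
have k0 : (0 < k)%N by apply: leq_trans hk; rewrite expn_gt0.
have dle x y s : delta_cut G1 G2 <= D1 x s + D2 y s.
  have [Y cY YD] := D1c x s; have [Z cZ ZD] := D2c y s.
  have u0 (j : 'I_k) : 0 < #|'I_k|%:R^-1 :> R by rewrite invr_gt0 ltr0n card_ord.
  have [X cX XD] := glue_couplings u0 cY cZ YD ZD.
  by apply: (delta_cut_le wG1 wG2 _ cX XD); rewrite addr_ge0.
have sign_ge0 (V : finType) (G : wgraph R V) (uG : edgew_unit G)
    (x : {ffun 'I_k -> V}) s : 0 <= sign_prob G x s.
  apply: prodr_ge0 => d _.
  by case: (is_dist_sign_law (fun i j => edgew_norm_le1 uG (x i) (x j)) d).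
have w_ge0 (V : finType) (G : wgraph R V) (wG : weighted_graph G) (uG : edgew_unit G)
    (x : {ffun 'I_k -> V}) s :
    0 <= (\prod_i nodew (wnormalize G) (x i)) * sign_prob G x s.
  by rewrite mulr_ge0 ?sign_ge0 // prodr_ge0 // => i _; apply/ltW/wnormalize_gt0.
have sum1 : \sum_s \sum_(x : {ffun 'I_k -> V1})
    (\prod_i nodew (wnormalize G1) (x i)) * sign_prob G1 x s = 1.
  rewrite exchange_big -[RHS](Ex_cst (fun _ : 'I_k => is_dist_wnormalize wG1) 1).
  apply: eq_bigr => x _; rewrite -mulr_sumr; congr (_ * _) => //.
  rewrite -[RHS](Ex_cst (is_dist_sign_law (fun i j => edgew_norm_le1 uG1 (x i) (x j))) 1).
  by apply: eq_bigr => s _; rewrite mulr1.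
have d0 : 0 <= delta_cut G1 G2.
  have [X oX cX] := delta_cut_attained wG1 wG2.
  apply: le_trans (normr_ge0 _) (cX (fun=> 0) (fun=> 0) _ _) => z;
    by rewrite lexx ler01.
have [v2 _] : exists v : V2, true.
  by have [/card_gt0P[v _] _ _] := wG2; exists v.
have tv s : `|\sum_(x : {ffun 'I_k -> V1})
      (\prod_i nodew (wnormalize G1) (x i)) * sign_prob G1 x s
    - \sum_(x : {ffun 'I_k -> V2})
      (\prod_i nodew (wnormalize G2) (x i)) * sign_prob G2 x s|
    <= 3 ^- (k ^ 2).
  apply: sign_prob_dist; first by rewrite invr_ge0 exprn_ge0.
  by move=> F; rewrite card_ord; exact: close.
have := common_observation (w_ge0 _ _ wG1 uG1) (w_ge0 _ _ wG2 uG2) D10 D20 sum1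
  [ffun=> v2] d0 tv dle D1e D2e.
rewrite card_ffun card_bool card_prod card_ord mulnn natrX.
(* The number of sign patterns times the distance of their probabilities. The resulting factor
   99/100 turns the total error 6.3 into less than 6.6. *)
have small : 2 ^+ (k ^ 2) * 3 ^- (k ^ 2) <= 1 / 100 :> R.
  rewrite -exprVn -exprMn; apply: (@le_trans _ _ ((2 / 3) ^+ 16)).
    apply: ler_wiXn2l; [lra|lra|].
    rewrite -[16%N]/(4 ^ 2)%N leq_exp2r //; apply: leq_trans hk.
    rewrite -[4%N]/(2 ^ 2)%N leq_exp2l //.
    by apply: leq_trans (leq_pmull h _) => //; apply: leq_trans h12.
  by lra.
move=> main; have h0 : (0 < h)%N by apply: leq_trans h12.
set r := Num.sqrt h%:R in main *.
have r0 : 0 < r by rewrite sqrtr_gt0 ltr0n.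
rewrite ler_pdivlMr //; move: main.
have -> : 315 / 100 / r + 315 / 100 / r = 63 / 10 / r by field; rewrite gt_eqF.
rewrite ler_pdivlMr //.
have := ler_wpM2l (mulr_ge0 d0 (ltW r0)) small.
by have := mulr_ge0 d0 (ltW r0); lra.
Qed.

End DeltaCut.

(** * Numerical estimates and conclusion *)

Lemma mul2_le22 (R : realFieldType) (s : R) :
  0 < s -> s ^+ 2 <= 121 -> 2 * s <= 22.
Proof.
move=> s0 s2; rewrite leNgt; apply/negP => lt22.
have s11 : 0 < s - 11 by lra.
by have := mulr_gt0 s11 s11; lra.
Qed.

(** Squaring reduces the claim to [435.6 * (r ^+ 2 + 1) <= 484 * r ^+ 2], true once
    [r ^+ 2 >= 9]. *)
Lemma ratio_le22 (R : realFieldType) (r s : R) : 0 < r -> 0 < s ->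
  12 <= r ^+ 2 -> s ^+ 2 <= 10 * r ^+ 2 + 10 -> 66 / 10 * s <= 22 * r.
Proof.
move=> r0 s0 r12 sr; rewrite leNgt; apply/negP => lt.
have d0 : 0 < 66 / 10 * s - 22 * r by lra.
have p0 : 0 < 66 / 10 * s + 22 * r by lra.
by have := mulr_gt0 d0 p0; nra.
Qed.

Theorem theorem2p7 (R : realType) (V1 V2 : finType)
    (G1 : wgraph R V1) (G2 : wgraph R V2)
    (wG1 : weighted_graph G1) (wG2 : weighted_graph G2)
    (uG1 : edgew_unit G1) (uG2 : edgew_unit G2) :
  (forall F : sgraph,
     `|hom_density F G1 - hom_density F G2|
       <= 4 * #|edges F|%:R * delta_cut G1 G2)
  /\
  (forall k : nat, (1 <= k)%N ->
     (forall F : sgraph, #|vertex F| = k ->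
        `|hom_density F G1 - hom_density F G2| <= 3 ^- (k ^ 2)) ->
     ((delta_cut G1 G2)%:E <=
        if k == 1%N then +oo else (22 / Num.sqrt (log2 k%:R))%:E)%E).
Proof.
split=> [F|k k0 close]; first exact: counting_delta_cut.
case: eqP => [_|/eqP k1]; first exact: leey.
rewrite lee_fin.
have k2 : (2 <= k)%N by rewrite ltn_neqAle eq_sym k1.
have ln2 : 0 < ln 2 :> R by rewrite ln_gt0 // ltr1n.
have log2_le m : (k <= 2 ^ m)%N -> log2 k%:R <= m%:R :> R.
  move=> km; rewrite /log2 ler_pdivrMr //.
  have -> : m%:R * ln 2 = ln (2 ^+ m) :> R by rewrite lnXn // mulr_natl.
  by rewrite ler_ln ?posrE ?exprn_gt0 ?ltr0n // -natrX ler_nat.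
have log2_gt0 : 0 < log2 k%:R :> R by rewrite divr_gt0 // ln_gt0 // ltr1n.
have sqrt_gt0 : 0 < Num.sqrt (log2 k%:R) :> R by rewrite sqrtr_gt0.
have sqr_log2 : Num.sqrt (log2 k%:R) ^+ 2 = log2 k%:R :> R.
  by rewrite sqr_sqrtr // ltW.
have sqr_le m : (k <= 2 ^ m)%N -> Num.sqrt (log2 k%:R) ^+ 2 <= m%:R :> R.
  by rewrite sqr_log2; exact: log2_le.
(* For [k <= 2 ^ 121] the trivial bound 2 suffices, since [121 = 11 ^ 2]. The exponent is kept
   opaque so that the power is not evaluated. *)
have [m mE] : exists m, m = 121%N by exists 121%N.
have [km|mk] := leqP k (2 ^ m).
  apply: (le_trans (delta_cut_le2 wG1 wG2 uG1 uG2)).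
  rewrite ler_pdivlMr //.
  by apply: mul2_le22 => //; have := sqr_le _ km; rewrite mE.
(* The largest [h] with [2 ^ (10 * h) <= k]; rounding down costs at most 10 in the logarithm, the
   summand 10 in [ratio_le22]. *)
pose h := (trunc_log 2 k %/ 10)%N.
have h12 : (12 <= h)%N.
  rewrite leq_divRL //; apply: (trunc_log_max (ltnSn 1)).
  by apply: leq_trans (ltnW mk); rewrite leq_exp2l // mE.
have hk : (2 ^ (10 * h) <= k)%N.
  apply: leq_trans (trunc_logP (ltnSn 1) k0).
  by rewrite leq_exp2l // mulnC leq_trunc_div.
have kh : (k <= 2 ^ (10 * h + 10))%N.
  apply: leq_trans (ltnW (trunc_log_ltn k (ltnSn 1))) _; rewrite leq_exp2l //.
  by rewrite -mulnSr mulnC ltn_ceil.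
apply: (le_trans (delta_cut_sampling wG1 wG2 uG1 uG2 h12 hk close)).
have := sqr_le _ kh; rewrite natrD natrM.
have h0 : 0 < h%:R :> R by rewrite ltr0n; apply: leq_trans h12.
have : 12 <= h%:R :> R by rewrite ler_nat.
rewrite -{1 2}(sqr_sqrtr (ltW h0)) => r12 sr.
rewrite ler_pdivlMr // mulrAC ler_pdivrMr ?sqrtr_gt0 //.
by apply: ratio_le22; rewrite ?sqrtr_gt0.
Qed.
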